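(* Let $T\ge1$ be an integer, $0<\epsilon<1$, $\kappa=1-\epsilon^2$, and let $v$ be the value function and $u$ the function defined in the context, with parameters $$\sigma=2\epsilon\Big/\log\Big(\frac{1+\epsilon}{1-\epsilon}\Big),\qquad b=\frac1\epsilon .$$ Then $$|u(0,(\epsilon T,\epsilon T),-T)-v(0,(\epsilon T,\epsilon T),-T)|\le E_0(-T),$$ where the error term $E_0(-T)$ is $O\big(1+(1+\frac1\sigma)\sqrt\kappa\big)$. As $\epsilon\to0$, the leading order term of $E_0(-T)$ is $O(1)$.
   Context: $O(\cdot)$ is understood with an absolute constant, independent of $T\ge1$ and $\epsilon\in(0,1)$; ''as $\epsilon\to0$, $O(1)$'' means bounded by an absolute constant for all sufficiently small $\epsilon$ and all $T\ge1$. State variables: $\eta\in\mathbb R$, $\xi=(\xi^h,\xi^r)\in\mathbb R^2$, time $t\le0$. Let $\mu(\eta,\xi)=\frac12(\eta+|\xi^r+\xi^h|)$. Value function $v$ (final-time regret of the symmetric two-armed Bernoulli bandit with centered rewards, when the myopic player is used, started at time $t$ from state $(\eta,\xi)$): $v(\eta,\xi,0)=\mu(\eta,\xi)$ and, for integers $t\le-1$, $$v(\eta,\xi,t)=\mathbb E\big[v(\eta+d\eta,\xi+d\xi,t+1)\big].$$ Here $g_1,g_2\in\{-1,1\}$ are independent, with $P(g_1=1)=\frac{1+\epsilon}2$ (safe arm 1) and $P(g_2=1)=\frac{1-\epsilon}2$ (risky arm 2); $I\in\{1,2\}$ is independent of $(g_1,g_2)$ and sampled from $p^m(\xi^r,t)$,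 where $p^m(\xi^r,t)$ equals $(1,0)$ if $\xi^r+\epsilon t>0$, $(\frac12,\frac12)$ if $\xi^r+\epsilon t=0$, and $(0,1)$ if $\xi^r+\epsilon t<0$; and $$d\eta=g_1+g_2-2g_I,\qquad d\xi=\big(g_1\mathbf 1_{\{I=2\}}-g_2\mathbf 1_{\{I=1\}}-\epsilon,\; g_1\mathbf 1_{\{I=1\}}-g_2\mathbf 1_{\{I=2\}}-\epsilon\big).$$ The domain of $v$ is restricted to $(\eta,\xi,t)$ such that $\eta$, $\xi^h+\epsilon t$, $\xi^r+\epsilon t$ are integers. Function $u$: for $t<0$ and parameters $\sigma,b>0$, $$u(\eta,\xi,t)=u^h(\eta,\xi^r+\xi^h,t)+u^n(\xi^r,t),$$ $$u^h(\eta,z,t)=\frac12\Big(\eta+\int_{\mathbb R}\Phi(z-s,2t)|s|\,ds\Big),\qquad \Phi(s,t)=\frac1{\sqrt{-2\pi\kappa t}}\exp\Big(\frac{s^2}{2\kappa t}\Big),$$ $$u^n(\xi^r,t)=\varphi(\xi^r+\epsilon t)-\hat\varphi(\xi^r,t),\qquad \hat\varphi(\xi^r,t)=\int_{\mathbb R}\Phi(\xi^r-s,t)\varphi(s)\,ds,$$ with $\varphi(y)=-y$ for $y\le0$ and $\varphi(y)=y+b e^{-2\epsilon y/\sigma}-b$ for $y>0$. (Here $\Phi$ always uses $\kappa=1-\epsilon^2$, while $\varphi$ uses $\sigma$.) *)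

(* Defs.v *)
From HB Require Import structures.
From mathcomp Require Import all_boot all_order all_algebra.
From mathcomp Require Import all_classical all_reals all_analysis.
Import Order.TTheory GRing.Theory Num.Theory.
Import numFieldNormedType.Exports.

Set Implicit Arguments.
Unset Strict Implicit.
Unset Printing Implicit Defensive.

Local Open Scope ring_scope.

(* A state is (eta, xi) with xi = (xi^h, xi^r), so xi.1 = xi^h, xi.2 = xi^r. *)

Definition mu (R : realType) (eta : R) (xi : R * R) : R :=
  (eta + `|xi.2 + xi.1|) / 2.

(* Encodings: a reward g in {-1, 1} is a boolean, true standing for 1;
   an arm I in {1, 2} is a boolean, true standing for arm 1 (safe). *)

Definition reward (R : realType) (g : bool) : R := if g then 1 else -1.

Definition law_g1 (R : realType) (eps : R) (g : bool) : R :=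
  if g then (1 + eps) / 2 else 1 - (1 + eps) / 2.

Definition law_g2 (R : realType) (eps : R) (g : bool) : R :=
  if g then (1 - eps) / 2 else 1 - (1 - eps) / 2.

(* The myopic player p^m(xi^r, t), as the law of I. *)
Definition myopic (R : realType) (eps xir t : R) (I : bool) : R :=
  if 0 < xir + eps * t then (if I then 1 else 0)
  else if xir + eps * t == 0 then 1 / 2
  else (if I then 0 else 1).

Definition deta (R : realType) (g1 g2 I : bool) : R :=
  reward R g1 + reward R g2 - 2 * reward R (if I then g1 else g2).

Definition dxi (R : realType) (eps : R) (g1 g2 I : bool) : R * R :=
  (reward R g1 *+ (~~ I) - reward R g2 *+ I - eps,
   reward R g1 *+ I - reward R g2 *+ (~~ I) - eps).

(* Value with n rounds to go, i.e. at time t = -n.  As (g1, g2, I) are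
   independent, the expectation is the sum against the product law.  The
   recursion makes sense for all real states; it preserves the lattice where
   eta, xi^h + eps t and xi^r + eps t are integers, so on that lattice it is
   the recursion restricted to the lattice. *)
Fixpoint value (R : realType) (eps eta : R) (xi : R * R) (n : nat) : R :=
  if n is m.+1 then
    \sum_(g1 : bool) \sum_(g2 : bool) \sum_(I : bool)
      law_g1 eps g1 * law_g2 eps g2 * myopic eps xi.2 (- n%:R) I *
      value eps (eta + deta R g1 g2 I)
        (xi.1 + (dxi eps g1 g2 I).1, xi.2 + (dxi eps g1 g2 I).2) m
  else mu eta xi.

(* Meaningful for t <= 0 only. *)
Definition v (R : realType) (eps eta : R) (xi : R * R) (t : int) : R :=
  value eps eta xi `|t|%N.

Definition kappa (R : realType) (eps : R) : R := 1 - eps ^+ 2.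

(* Meaningful for t < 0 only, as are the functions below that use it. *)
Definition Phi (R : realType) (eps s t : R) : R :=
  (Num.sqrt (- 2 * pi * kappa eps * t))^-1 *
  expR (s ^+ 2 / (2 * kappa eps * t)).

Definition varphi (R : realType) (eps sigma b y : R) : R :=
  if y <= 0 then - y else y + b * expR (- (2 * eps * y / sigma)) - b.

Definition varphi_hat (R : realType) (eps sigma b xir t : R) : R :=
  \int[lebesgue_measure]_(s in setT)
    (Phi eps (xir - s) t * varphi eps sigma b s).

Definition u_h (R : realType) (eps eta z t : R) : R :=
  (eta + \int[lebesgue_measure]_(s in setT)
           (Phi eps (z - s) (2 * t) * `|s|)) / 2.

Definition u_n (R : realType) (eps sigma b xir t : R) : R :=
  varphi eps sigma b (xir + eps * t) - varphi_hat eps sigma b xir t.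

Definition u (R : realType) (eps sigma b eta : R) (xi : R * R) (t : R) : R :=
  u_h eps eta (xi.2 + xi.1) t + u_n eps sigma b xi.2 t.

Definition sigma0 (R : realType) (eps : R) : R :=
  2 * eps / ln ((1 + eps) / (1 - eps)).

Definition b0 (R : realType) (eps : R) : R := 1 / eps.

(* Main.v *)
Require Import Defs.
From HB Require Import structures.
From mathcomp Require Import all_boot all_order all_algebra.
From mathcomp Require Import all_classical all_reals all_analysis.
From mathcomp Require Import measurable_realfun ring lra.
Import Order.TTheory GRing.Theory Num.Theory.
Import numFieldNormedType.Exports.

(** The coordinates [xi^r + eps t] and [xi^h + eps t] perform independent +-1 walks of
    drift [eps], whichever arm is played.  With [S_n] such a walk started at 0 this gives
    [v = E|S_2T| / 2 - E|S_T| + E sgn(S_T) / eps].  As a function of [eps], [E sgn(S_n)] is a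
    polynomial with derivative [c_m (1 - eps^2)^m], where [m] is the integer part of
    [(n - 1) / 2], and [E|S_n| = n eps E sgn(S_n) + (1 - eps^2) c_m (1 - eps^2)^m].

    On the other side [varphi y = |y| - (1 - exp(-lambda max(y, 0))) / eps] with
    [lambda = ln((1 + eps) / (1 - eps))].  Replacing [lambda] by [2 eps / kappa], which costs
    [O(1)], makes the exponential tilt a reflection of the Gaussian law [N] of mean [n eps]
    and variance [n kappa], so that [u] becomes the same combination of [E|N|] and [E sgn N],
    two quantities expressed by [erf] and the Gaussian density at 0.

    It remains to compare [E sgn(S_n)] with [E sgn N].  The bounds
    [(1 - x^2)^m <= exp(-m x^2)] and [(1 + t^2)^-(m + 3/2) >= exp(-(m + 3/2) t^2)], with
    [x = t / sqrt(1 + t^2)], integrate to two-sided bounds of the polynomial by [erf]; their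
    limit cases at [x = 1] also pin down the constant [c_m].  The resulting relative error is
    [O(1/n)], so the error of [E|.|] is [O(1)], uniformly in [eps] and [n]. *)

Set Implicit Arguments.
Unset Strict Implicit.
Unset Printing Implicit Defensive.

Local Open Scope ring_scope.

(** * Biased walks and the value function *)

Section biased_walk.
Context {R : realType}.
Implicit Types (eps x : R) (f g : R -> R) (n m : nat).

Definition walk_step eps f x := (1 + eps) / 2 * f (x + 1) + (1 - eps) / 2 * f (x - 1).

(** [walk_mean eps n f x] is E f(x + S_n), where each step of S is 1 with probability (1 + eps)/2
    and -1 otherwise. *)
Definition walk_mean eps n f := iter n (walk_step eps) f.
Arguments walk_mean : simpl never.

Lemma walk_mean0 eps f x : walk_mean eps 0 f x = f x.
Proof. by []. Qed.

Lemma walk_meanS eps n f x : walk_mean eps n.+1 f x =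
  (1 + eps) / 2 * walk_mean eps n f (x + 1) + (1 - eps) / 2 * walk_mean eps n f (x - 1).
Proof. by []. Qed.

Lemma walk_meanSr eps n f : walk_mean eps n.+1 f = walk_mean eps n (walk_step eps f).
Proof. exact: iterSr. Qed.

Lemma walk_mean_binomial eps n f x : walk_mean eps n f x =
  \sum_(k < n.+1) 'C(n, k)%:R * ((1 + eps) / 2) ^+ k * ((1 - eps) / 2) ^+ (n - k) *
    f (x + k%:R *+ 2 - n%:R).
Proof.
set p := (1 + eps) / 2; set q := (1 - eps) / 2.
pose F n x k := 'C(n, k)%:R * p ^+ k * q ^+ (n - k) * f (x + k%:R *+ 2 - n%:R).
elim: n x => [|n IHn] x.
  by rewrite big_ord1 bin0 !expr0 !mul1r mul0rn subr0 addr0.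
rewrite walk_meanS !IHn -/p -/q.
(* Pascal's rule, split according to the first step of the walk. *)
have FS k : (k <= n)%N -> F n.+1 x k.+1 = p * F n (x + 1) k + q * F n (x - 1) k.+1.
  move=> kn; rewrite /F binS natrD subSS.
  have -> : x + k.+1%:R *+ 2 - n.+1%:R = x + 1 + k%:R *+ 2 - n%:R.
    by rewrite -!natr1; ring.
  have -> : x - 1 + k.+1%:R *+ 2 - n%:R = x + 1 + k%:R *+ 2 - n%:R.
    by rewrite -!natr1; ring.
  have [kn'|nk] := ltnP k n.
    have -> : (n - k = (n - k.+1).+1)%N by rewrite subnSK.
    rewrite !exprS; ring.
  by rewrite (bin_small (n := n) (m := k.+1)) // exprS; ring.
have F0 : F n.+1 x 0 = q * F n (x - 1) 0.
  rewrite /F !bin0 !subn0 exprS (_ : x + _ - _ = x - 1 + 0 *+ 2 - n%:R); first by ring.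
  by rewrite -natr1; ring.
have -> : \sum_(k < n.+1) F n (x - 1) k = \sum_(k < n.+2) F n (x - 1) k.
  by rewrite [RHS]big_ord_recr /= {3}/F bin_small // !mul0r addr0.
rewrite -/(F n.+1 x _) [RHS](_ : _ = \sum_(k < n.+2) F n.+1 x k) //.
rewrite [RHS]big_ord_recl /= F0 [X in _ + _ * X = _]big_ord_recl mulrDr [LHS]addrCA; congr (_ + _).
rewrite !mulr_sumr -big_split /=; apply: eq_bigr => k _.
by rewrite /bump /= add1n FS // -ltnS.
Qed.

(** A walk started at 0 only reaches points 2k - n, so a function may be changed freely
    elsewhere. *)
Lemma eq_walk_mean eps n f g :
  (forall k : nat, (k <= n)%N -> f (k%:R *+ 2 - n%:R) = g (k%:R *+ 2 - n%:R)) ->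
  walk_mean eps n f 0 = walk_mean eps n g 0.
Proof.
move=> fg; rewrite !walk_mean_binomial; apply: eq_bigr => k _.
by rewrite add0r fg // -ltnS.
Qed.

Lemma walk_meanD eps n f g x :
  walk_mean eps n (fun y => f y + g y) x = walk_mean eps n f x + walk_mean eps n g x.
Proof. by elim: n x => // n IHn x; rewrite !walk_meanS !IHn; ring. Qed.

Lemma walk_meanZ eps n a f x :
  walk_mean eps n (fun y => a * f y) x = a * walk_mean eps n f x.
Proof. by elim: n x => // n IHn x; rewrite !walk_meanS !IHn; ring. Qed.

(** The probability that the symmetric walk is back at 0 at time 2j; the coefficient of y^j in (1 -
    y)^(-1/2). *)
Definition central_weight j : R := 'C(j.*2, j)%:R / 4 ^+ j.

Lemma walk_mean_point eps n k : (k <= n)%N ->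
  walk_mean eps n (fun y => (y == k%:R *+ 2 - n%:R)%:R) 0 =
  'C(n, k)%:R * ((1 + eps) / 2) ^+ k * ((1 - eps) / 2) ^+ (n - k).
Proof.
rewrite -ltnS => kn; rewrite walk_mean_binomial (bigD1 (Ordinal kn)) //= big1 => [|l lk].
  by rewrite addr0 add0r eqxx mulr1.
rewrite add0r (inj_eq (addIr _)) eqrMn2r eqr_nat.
by move: lk; rewrite -val_eqE /= => /negbTE ->; rewrite mulr0.
Qed.

Lemma walk_mean_off_parity eps n (a b : nat) : odd (n + a + b) ->
  walk_mean eps n (fun y => (y == a%:R - b%:R)%:R) 0 = 0 :> R.
Proof.
move=> nab; rewrite walk_mean_binomial big1 // => k _.
have -> : (0 + k%:R *+ 2 - n%:R == a%:R - b%:R :> R) = (k.*2 + b == a + n)%N.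
  by rewrite -(eqr_nat R) -addnn !natrD mulr2n; apply/eqP/eqP => ?; lra.
case: eqP => [/(congr1 odd)|_]; last by rewrite mulr0.
by move: nab; rewrite !oddD odd_double; case: (odd n) (odd a) (odd b) => [] [] [].
Qed.

Lemma walk_mean_zero_even eps j :
  walk_mean eps j.*2 (fun y => (y == 0)%:R) 0 = central_weight j * (1 - eps ^+ 2) ^+ j.
Proof.
have jn : (j <= j.*2)%N by rewrite -addnn leq_addr.
have /= := walk_mean_point eps jn; rewrite -[X in _ - X%:R]addnn natrD mulr2n subrr => ->.
rewrite -{2}addnn addnK /central_weight.
by rewrite -!mulrA -exprMn -exprVn -exprMn; congr (_ * _ ^+ _); by field.
Qed.

Lemma walk_mean_zero_odd eps j : walk_mean eps j.*2.+1 (fun y => (y == 0)%:R) 0 = 0.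
Proof.
have := @walk_mean_off_parity eps j.*2.+1 0%N 0%N; rewrite subrr; apply.
by rewrite !addn0 /= odd_double.
Qed.

(** Reflection matches the paths ending at 1 with those ending at -1, and the former have one more
    up-step and one less down-step. *)
Lemma walk_mean_at_one eps n :
  (1 - eps) / 2 * walk_mean eps n (fun y => (y == 1)%:R) 0 =
  (1 + eps) / 2 * walk_mean eps n (fun y => (y == -1)%:R) 0 :> R.
Proof.
have [nodd|neven] := boolP (odd n); last first.
  have := @walk_mean_off_parity eps n 1%N 0%N; have := @walk_mean_off_parity eps n 0%N 1%N.
  by rewrite subr0 sub0r !addn0 addn1 /= neven => -> // -> //; rewrite !mulr0.
have -> : n = n./2.*2.+1 by rewrite -[LHS]odd_double_half nodd.
move: n./2 => {nodd}j; have j1 : (j.+1 <= j.*2.+1)%N by rewrite ltnS -addnn leq_addr.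
have := walk_mean_point eps j1; have := walk_mean_point eps (ltnW j1).
rewrite (_ : j%:R *+ 2 - _ = -1); last by rewrite -natr1 -muln2 natrM; ring.
rewrite (_ : j.+1%:R *+ 2 - _ = 1); last by rewrite -!natr1 -muln2 natrM; ring.
move=> -> ->; rewrite subSS subSn -?addnn ?leq_addr // addnK.
rewrite -[in RHS]bin_sub ?addnn -?addnn; last by rewrite leqW ?leq_addr.
rewrite subSn ?leq_addr // addnK !exprS; ring.
Qed.

End biased_walk.

Arguments walk_mean : simpl never.

(** * The value function as a combination of walk means *)

Section value_of_the_game.
Context {R : realType}.
Implicit Types (eps eta x : R) (xi : R * R) (n m : nat).

(** Whichever arm is played, the shifted sum of the coordinates moves by g1 - g2, that is two walk
    steps, and the shifted xi^r moves by g1 or -g2, one walk step. Only the mean of [deta] depends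
    on the arm: -2 eps for arm 1, 2 eps for arm 2 and 0 for the fair coin, so the myopic rule
    contributes -eps times the sign of xi^r + eps t at each round. *)
Lemma value_walk_mean eps eta xi n : value eps eta xi n =
  (eta + walk_mean eps n.*2 Num.norm (xi.1 + xi.2 - eps * n%:R *+ 2)) / 2
  - eps * \sum_(k < n) walk_mean eps k Num.sg (xi.2 - eps * n%:R).
Proof.
elim: n eta xi => [|n IHn] eta [y x].
  by rewrite /= /mu /= big_ord0 !mulr0 mul0rn !subr0 [x + y]addrC.
set W := walk_mean eps n.*2 Num.norm.
pose S z := \sum_(k < n) walk_mean eps k Num.sg z.
pose s := y + x - eps * n.+1%:R *+ 2; pose a := x - eps * n.+1%:R.
have IH (g1 g2 I : bool) : value eps (eta + deta R g1 g2 I)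
    (y + (dxi eps g1 g2 I).1, x + (dxi eps g1 g2 I).2) n =
    (eta + deta R g1 g2 I + W (s + reward R g1 - reward R g2)) / 2
    - eps * S (a + (if I then reward R g1 else - reward R g2)).
  rewrite IHn /=; congr ((_ + W _) / 2 - _ * S _).
    by rewrite /s -natr1; case: I; rewrite !(mulr0n, mulr1n); ring.
  by rewrite /a -natr1; case: I; rewrite !(mulr0n, mulr1n); ring.
have Wstep : walk_mean eps n.+1.*2 Num.norm s =
    (1 + eps) / 2 * ((1 + eps) / 2 * W (s + 1 + 1) + (1 - eps) / 2 * W (s + 1 - 1)) +
    (1 - eps) / 2 * ((1 + eps) / 2 * W (s - 1 + 1) + (1 - eps) / 2 * W (s - 1 - 1)).
  by rewrite doubleS !walk_meanS.
have Sstep : \sum_(k < n.+1) walk_mean eps k Num.sg a = Num.sg a +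
    ((1 + eps) / 2 * S (a + 1) + (1 - eps) / 2 * S (a - 1)).
  by rewrite big_ord_recl /= /S !mulr_sumr -big_split.
rewrite [LHS]/= /snd /fst -/s -/a Wstep Sstep.
under eq_bigr do under eq_bigr do under eq_bigr do rewrite IH.
rewrite !big_bool /= /law_g1 /law_g2 /deta /reward /myopic mulrN -/a subr_eq0 -subr_eq0 -/a.
rewrite !opprK addrK subrK.
(* The three signs of [a] are the three branches of the myopic player. *)
have [a0|a0|a0] := ltrgt0P a; rewrite ?(gtr0_sg a0) ?(ltr0_sg a0) ?a0 ?sgr0.
- by field.
- by field.
- by field.
Qed.

End value_of_the_game.

(** * Mean sign and mean absolute value of the walk *)

Ltac indic_lra := rewrite ?eqxx; do ?[case: eqP => ?]; rewrite ?mulr1n ?mulr0n /=; lra.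

Section sign_and_absolute_value.
Context {R : realType}.
Implicit Types (eps x : R) (n m j : nat).

(** By integrality, the one-step averages of the sign and of the absolute value need special care
    only at 0, 1 and -1. *)
Lemma walk_lattice_cases k n (x := k%:R *+ 2 - n%:R : R) :
  [\/ x = 0, x = 1, x = -1 | 2 <= x \/ x <= -2].
Proof.
rewrite {}/x; have -> : k%:R *+ 2 - n%:R = (k.*2%:Z - n%:Z)%:~R :> R.
  by rewrite intrD mulrNz -!pmulrn -addnn natrD mulr2n.
case: (_ - _) => [[|[|z]]|[|z]].
- exact: Or41.
- exact: Or42.
- by apply: Or44; left; rewrite -pmulrn ler_nat.
- exact: Or43.
- by apply: Or44; right; rewrite NegzE mulrNz -pmulrn lerN2 ler_nat.
Qed.

(** Averaging [Num.sg] over one step changes it by eps at 0, by -(1 - eps)/2 at 1 and by (1 + eps)/2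
    at -1. The last two contributions cancel by [walk_mean_at_one]. *)
Lemma walk_mean_sgS eps n : walk_mean eps n.+1 Num.sg 0 =
  walk_mean eps n Num.sg 0 + eps * walk_mean eps n (fun y => (y == 0)%:R) 0 :> R.
Proof.
rewrite walk_meanSr (@eq_walk_mean R eps n _ (fun y => Num.sg y + (eps * (y == 0)%:R +
  (- ((1 - eps) / 2) * (y == 1)%:R + (1 + eps) / 2 * (y == -1)%:R)))); last first.
  move=> k _; rewrite /walk_step; have [->|->|->|[y2|y2]] := walk_lattice_cases k n.
  - rewrite add0r sub0r sgrN sgr1 sgr0 eqxx; indic_lra.
  - rewrite (subrr 1) sgr0 sgr1 gtr0_sg ?eqxx; indic_lra.
  - rewrite (addNr 1) sgr0 sgrN sgr1 ltr0_sg ?eqxx; indic_lra.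
  - rewrite !gtr0_sg; indic_lra.
  - rewrite !ltr0_sg; indic_lra.
rewrite !walk_meanD !walk_meanZ mulNr walk_mean_at_one.
by rewrite addNr addr0.
Qed.

(** A discrete Tanaka formula: the absolute value grows by the drift times the sign, plus a unit of
    local time at each visit to 0. *)
Lemma walk_mean_normS eps n : walk_mean eps n.+1 Num.norm 0 =
  walk_mean eps n Num.norm 0 +
  (walk_mean eps n (fun y => (y == 0)%:R) 0 + eps * walk_mean eps n Num.sg 0) :> R.
Proof.
rewrite walk_meanSr (@eq_walk_mean R eps n _ (fun y => `|y| + ((y == 0)%:R +
  eps * Num.sg y))); last first.
  move=> k _; rewrite /walk_step; have [->|->|->|[y2|y2]] := walk_lattice_cases k n.
  - rewrite add0r sub0r normrN normr1 normr0 sgr0 eqxx; indic_lra.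
  - rewrite (subrr 1) normr0 normr1 sgr1 ger0_norm; indic_lra.
  - rewrite (addNr 1) normr0 normrN normr1 sgrN sgr1 ler0_norm; indic_lra.
  - rewrite !ger0_norm ?gtr0_sg; indic_lra.
  - rewrite !ler0_norm ?ltr0_sg; indic_lra.
by rewrite !walk_meanD !walk_meanZ.
Qed.

Lemma central_weight0 : central_weight 0 = 1 :> R.
Proof. by rewrite /central_weight bin0 expr0 divr1. Qed.

Lemma central_weightS j :
  j.+1.*2%:R * central_weight j.+1 = j.*2.+1%:R * central_weight j :> R.
Proof.
have jj : (j <= j.*2)%N by rewrite -addnn leq_addr.
have := mul_bin_diag j.*2.+2 j; have := mul_bin_down j.*2.+1 j.
rewrite /central_weight doubleS subSn // -[X in (X - j)%N]addnn addnK exprS /=.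
have : 4 ^+ j != 0 :> R by rewrite expf_neq0 // pnatr_eq0.
move: 'C(_, _) 'C(_, _) 'C(_, _) (4 ^+ j) => a b c d d0.
rewrite -doubleS -[j.+1.*2]muln2 -mulnA [X in _ = X -> _]mulnC [X in X = _ -> _]mulnC.
move=> cb /eqP; rewrite eqn_pmul2l // => /eqP <-.
have {}cb : c%:R * j.*2.+1%:R = b%:R * j.+1%:R :> R by rewrite -!natrM cb.
rewrite [in RHS]mulrA [_%:R * c%:R]mulrC cb !natrM invfM.
by field.
Qed.

(** A partial sum of the binomial series of x (1 - (1 - x^2))^(-1/2), which is the sign of x. *)
Definition sign_poly m x := \sum_(j < m.+1) central_weight j * (x * (1 - x ^+ 2) ^+ j) : R.

(** The derivative of [sign_poly m] at 0, of order 2 sqrt(m / pi). *)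
Definition sign_slope m : R := m.*2.+1%:R * central_weight m.

Lemma sign_polyS m x :
  sign_poly m.+1 x = sign_poly m x + central_weight m.+1 * (x * (1 - x ^+ 2) ^+ m.+1).
Proof. by rewrite /sign_poly big_ord_recr. Qed.

Lemma sign_poly0 x : sign_poly 0 x = x.
Proof. by rewrite /sign_poly big_ord1 central_weight0 expr0 mulr1 mul1r. Qed.

Lemma sign_slope0 : sign_slope 0 = 1.
Proof. by rewrite /sign_slope central_weight0 mulr1. Qed.

Lemma sign_slope_ge0 m : 0 <= sign_slope m.
Proof. by rewrite /sign_slope /central_weight !mulr_ge0 // invr_ge0 exprn_ge0. Qed.

Lemma sign_slopeE m : sign_slope m = m.+1.*2%:R * central_weight m.+1.
Proof. by rewrite central_weightS. Qed.

Lemma walk_mean_sg_odd eps m : walk_mean eps m.*2.+1 Num.sg 0 = sign_poly m eps.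
Proof.
elim: m => [|m IHm].
  rewrite sign_poly0 walk_mean_sgS (walk_mean_zero_even eps 0) walk_mean0 sgr0.
  by rewrite central_weight0 !mulr1 add0r.
rewrite walk_mean_sgS walk_mean_zero_even doubleS walk_mean_sgS IHm walk_mean_zero_odd.
by rewrite mulr0 addr0 sign_polyS mulrCA.
Qed.

(** The walk is never at 0 at an odd time, so the mean sign is the same at times 2m + 1 and 2m +
    2. *)
Lemma walk_mean_sg eps n : (0 < n)%N -> walk_mean eps n Num.sg 0 = sign_poly n.-1./2 eps.
Proof.
case: n => // n _; rewrite -[n in LHS]odd_double_half /=.
case: (odd n) => /=; last by rewrite add0n walk_mean_sg_odd.
by rewrite add1n walk_mean_sgS walk_mean_sg_odd walk_mean_zero_odd mulr0 addr0.
Qed.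

Lemma walk_mean_norm_odd eps m (k := 1 - eps ^+ 2) : walk_mean eps m.*2.+1 Num.norm 0 =
  m.*2.+1%:R * eps * sign_poly m eps + k * sign_slope m * k ^+ m.
Proof.
elim: m => [|m IHm].
  rewrite walk_mean_normS (walk_mean_zero_even eps 0) !walk_mean0 normr0 sgr0 central_weight0.
  by rewrite sign_poly0 sign_slope0 !expr0 double0 /k; ring.
rewrite walk_mean_normS walk_mean_zero_even walk_mean_sg //=.
rewrite uphalf_double doubleS walk_mean_normS walk_mean_zero_odd walk_mean_sg_odd IHm.
rewrite sign_polyS sign_slopeE /sign_slope -/k !exprS doubleS.
have -> : m.*2.+3%:R = m.*2.+2%:R + 1 :> R by rewrite natr1.
have -> : m.*2.+1%:R = m.*2.+2%:R - 1 :> R by rewrite -[m.*2.+2%:R]natr1 addrK.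
(* With the power abstracted, unfolding [k] lets [ring] use eps^2 = 1 - k. *)
move: (k ^+ m) => km; rewrite /k; ring.
Qed.

Lemma walk_mean_norm eps n (k := 1 - eps ^+ 2) : (0 < n)%N -> walk_mean eps n Num.norm 0 =
  n%:R * eps * sign_poly n.-1./2 eps + k * sign_slope n.-1./2 * k ^+ n.-1./2.
Proof.
case: n => // n _; rewrite -[n in LHS]odd_double_half -[n in n.+1%:R]odd_double_half /=.
case: (odd n) => /=; last by rewrite add0n walk_mean_norm_odd.
rewrite add1n walk_mean_normS walk_mean_norm_odd walk_mean_zero_odd walk_mean_sg_odd -/k.
by rewrite -natr1 -/k; move: (k ^+ _) => km; rewrite /k; ring.
Qed.

End sign_and_absolute_value.

(** * The error function and Gaussian integrals *)

Section error_function.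
Context {R : realType}.
Notation mu := (@lebesgue_measure R).
Local Open Scope classical_set_scope.

Lemma is_derive_ge0_le (f df : R -> R) (a b : R) : a <= b ->
  (forall x, a <= x <= b -> is_derive x 1 f (df x)) ->
  (forall x, a <= x <= b -> 0 <= df x) -> f a <= f b.
Proof.
move=> ab fdf df0; rewrite -subr_ge0.
have [x xab||x xab ->] := @MVT_segment R f df a b ab.
- by apply: fdf; rewrite !(itvP xab).
- apply: derivable_within_continuous => x xab.
  by have [] := fdf x; rewrite ?(itvP xab).
- by rewrite mulr_ge0 ?subr_ge0// df0 // !(itvP xab).
Qed.

Lemma integrable_gauss_itv (i : interval R) : mu.-integrable [set` i] (EFin \o gauss_fun).
Proof.
exact: (@integrableS _ _ _ mu setT [set` i] (EFin \o gauss_fun) measurableT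
  (measurable_itv i) (@subsetT _ _) (@integrableT_gauss R)).
Qed.

(** Integrating from minus infinity makes the fundamental theorem of calculus apply at every real x,
    so [erf] is differentiable on both sides of 0. *)
Definition gauss_cumulative (x : R) : R := \int[mu]_(t in `]-oo, x]) gauss_fun t.

Definition erf (x : R) : R :=
  2 / Num.sqrt pi * (gauss_cumulative x - gauss_cumulative 0).

Lemma is_derive_gauss_cumulative (x : R) : is_derive x 1 gauss_cumulative (gauss_fun x).
Proof.
have x1 : x < x + 1 by rewrite ltrDl.
have intg := integrable_gauss_itv (Interval -oo%O (BRight (x + 1))).
have [| |d e] := continuous_FTC1 x1 intg.
- by rewrite ltNyr.
- exact: continuous_gauss_fun.
by apply: DeriveDef d _; rewrite -derive1E.
Qed.

Global Instance is_derive_erf (x : R) : is_derive x 1 erf (2 / Num.sqrt pi * gauss_fun x).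
Proof.
have d := is_derive_gauss_cumulative x.
by apply: is_derive_eq; rewrite subr0.
Qed.

Lemma erf0 : erf 0 = 0.
Proof. by rewrite /erf subrr mulr0. Qed.

Lemma erfE (x : R) : 0 < x ->
  erf x = 2 / Num.sqrt pi * gauss_integral_proof.integral0_gauss x.
Proof.
move=> x0; congr (_ * _); rewrite /gauss_cumulative.
rewrite Rintegral_itvB ?bnd_simp ?(ltW x0) //; last exact: integrable_gauss_itv.
by rewrite Rintegral_itv_obnd_cbnd //; exact: integrable_gauss_itv.
Qed.

(** The Gaussian integral is known through its square, which tends to pi / 4; nonnegativity allows
    taking the square root. *)
Lemma erf_cvgy : erf x @[x --> +oo%R] --> (1 : R).
Proof.
have pi0 : Num.sqrt pi != 0 :> R by rewrite gt_eqF // sqrtr_gt0 pi_gt0.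
have -> : 1 = 2 / Num.sqrt pi * Num.sqrt (pi / 4) :> R.
  rewrite sqrtrM ?pi_ge0// sqrtrV// (_ : 4 = 2 ^+ 2); last by rewrite expr2; ring.
  by rewrite sqrtr_sqr ger0_norm//; field.
have : 2 / Num.sqrt pi * Num.sqrt (@gauss_integral_proof.integral0_gauss R x ^+ 2)
    @[x --> +oo%R] --> 2 / Num.sqrt pi * Num.sqrt (pi / 4).
  apply: cvgMl_tmp.
  apply: continuous_cvg; first exact: sqrt_continuous.
  exact: gauss_integral_proof.cvg_integral0_gauss_sqr.
apply: cvg_trans; apply: near_eq_cvg; near=> x.
rewrite erfE; last by near: x; exact: nbhs_pinfty_gt.
by rewrite sqrtr_sqr ger0_norm // gauss_integral_proof.integral0_gauss_ge0.
Unshelve. all: by end_near. Qed.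

Lemma erfN (x : R) : erf (- x) = - erf x.
Proof.
have : (erf \o -%R + erf) x = (erf \o -%R + erf) 0.
  apply: is_derive_0_is_cst => y; apply: is_derive_eq.
  by rewrite /gauss_fun sqrrN; ring.
by rewrite !fctE /= oppr0 erf0 => /eqP; rewrite addr0 addr_eq0 => /eqP.
Qed.

Lemma le_erf : {homo erf : x y / x <= y}.
Proof.
move=> x y xy; apply: (is_derive_ge0_le xy) => z _.
by rewrite !mulr_ge0 // ?invr_ge0 // gauss_fun_ge0.
Qed.

Lemma erf_ge0 (x : R) : 0 <= x -> 0 <= erf x.
Proof. by move=> x0; rewrite -erf0 le_erf. Qed.

Lemma erf_le1 (x : R) : erf x <= 1.
Proof.
rewrite -(cvg_lim _ erf_cvgy) //; apply: limr_ge; first exact: cvgP erf_cvgy.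
by near=> y; apply: le_erf; near: y; exact: nbhs_pinfty_ge (num_real x).
Unshelve. all: by end_near. Qed.

Lemma sqrt_pi_ge1 : 1 <= Num.sqrt pi :> R.
Proof. by rewrite -[leLHS]sqrtr1 ler_sqrt ?pi_gt0 // (le_trans _ (pi_ge2 R)) // ler1n. Qed.

Lemma erf_le (x : R) : 0 <= x -> erf x <= 2 * x.
Proof.
move=> x0; rewrite -subr_ge0 -[leLHS](_ : 2 * 0 - erf 0 = 0); last by rewrite erf0; ring.
apply: (@is_derive_ge0_le (fun x => 2 * x - erf x)
  (fun x => 2 - 2 / Num.sqrt pi * gauss_fun x)) => // y _.
  by apply: is_derive_eq; rewrite /GRing.scale /= mulr1.
rewrite subr_ge0 -mulrA ler_piMr // mulrC -[leRHS]mulr1 ler_pM ?gauss_fun_ge0 ?gauss_fun_le1 //.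
by rewrite invf_le1 ?sqrt_pi_ge1 // (lt_le_trans ltr01 sqrt_pi_ge1).
Qed.

End error_function.

(** * Half-line and absolute moments of a normal law *)

Section normal_integrals.
Context {R : realType}.
Notation mu := (@lebesgue_measure R).
Local Open Scope classical_set_scope.
Implicit Types (y s x : R).

Global Instance is_derive_gauss_fun x : is_derive x 1 gauss_fun (- 2 * x * gauss_fun x).
Proof.
have d : is_derive x 1 (expR \o (fun x : R => - x ^+ 2)) (expR (- x ^+ 2) * - (2 * x)).
  by apply: is_derive1_comp; apply: is_derive_eq; rewrite /GRing.scale /=; ring.
by apply: is_derive_eq; rewrite /gauss_fun; ring.
Qed.

(** This is s sqrt 2, the scale that turns the normal density into exp(-x^2). *)
Definition normal_scale s : R := Num.sqrt (s ^+ 2 *+ 2).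

Lemma normal_scale_gt0 s : 0 < s -> 0 < normal_scale s.
Proof. by move=> s0; rewrite sqrtr_gt0 pmulrn_lgt0 // exprn_gt0. Qed.

Lemma normal_scale_sqr s : normal_scale s ^+ 2 = s ^+ 2 *+ 2.
Proof. by rewrite sqr_sqrtr // mulrn_wge0 // sqr_ge0. Qed.

Lemma normal_pdf_gauss_fun y s x : 0 < s -> normal_pdf y s x =
  (normal_scale s * Num.sqrt pi)^-1 * gauss_fun ((x - y) / normal_scale s).
Proof.
move=> s0; rewrite normal_pdfE ?gt_eqF //; congr (_^-1 * expR _).
  by rewrite -mulrnAl sqrtrM // mulrn_wge0 // sqr_ge0.
by rewrite expr_div_n normal_scale_sqr mulNr.
Qed.

Lemma normal_scale_affine_cvgy y s : 0 < s ->
  (x - y) / normal_scale s @[x --> +oo%R] --> +oo%R.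
Proof.
move=> s0; apply: gt0_cvgMly; last exact: cvg_addrr.
by rewrite invr_gt0 normal_scale_gt0.
Qed.

Lemma integral_normal_pdf_half_line y s : 0 < s ->
  (\int[mu]_(x in `[0%R, +oo[) (normal_pdf y s x)%:E)%E =
  ((1 + erf (y / normal_scale s)) / 2)%:E.
Proof.
move=> s0; have r0 := normal_scale_gt0 s0; set r := normal_scale s in r0 *.
have sp0 : 0 < Num.sqrt pi :> R by rewrite sqrtr_gt0 pi_gt0.
pose F x := 2^-1 * erf ((x - y) / r).
have dF x : is_derive x 1 F (normal_pdf y s x).
  have d : is_derive x 1 (erf \o (fun x => (x - y) / r))
      (2 / Num.sqrt pi * gauss_fun ((x - y) / r) * r^-1).
    by apply: is_derive1_comp; apply: is_derive_eq; rewrite /GRing.scale /=; ring.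
  apply: is_derive_eq; rewrite normal_pdf_gauss_fun // -/r /GRing.scale /=; field.
  by rewrite (gt_eqF sp0) (gt_eqF r0).
rewrite (@ge0_continuous_FTC2y R _ F 0 2^-1).
- rewrite -EFinB /F sub0r mulNr erfN; congr EFin; by field.
- by move=> x _; exact: normal_pdf_ge0.
- by apply: continuous_subspaceT; apply: continuous_normal_pdf; rewrite gt_eqF.
- rewrite -[X in _ --> X]mulr1; apply: cvgMl_tmp.
  exact: (cvg_comp _ _ (normal_scale_affine_cvgy y s0) erf_cvgy).
- by move=> x _; have [] := dF x.
- apply/cvg_at_right_filter.
  by apply: differentiable_continuous; apply/derivable1_diffP; have [] := dF 0.
- by move=> x _; rewrite derive1E; have [] := dF x.
Qed.

Lemma integral_id_normal_pdf_half_line y s : 0 < s ->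
  (\int[mu]_(x in `[0%R, +oo[) (normal_pdf y s x * x)%:E)%E =
  (y * (1 + erf (y / normal_scale s)) / 2 +
   normal_scale s / (2 * Num.sqrt pi) * gauss_fun (y / normal_scale s))%:E.
Proof.
move=> s0; have r0 := normal_scale_gt0 s0; set r := normal_scale s in r0 *.
have sp0 : 0 < Num.sqrt pi :> R by rewrite sqrtr_gt0 pi_gt0.
(* Writing x = y + (x - y), the first part integrates to [erf], and the second is a multiple of the
   derivative of the density. *)
pose F x := y / 2 * erf ((x - y) / r) - r / (2 * Num.sqrt pi) * gauss_fun ((x - y) / r).
have dF x : is_derive x 1 F (normal_pdf y s x * x).
  have da : is_derive x 1 (fun x => (x - y) / r) r^-1.
    by apply: is_derive_eq; rewrite /GRing.scale /=; ring.
  have d1 : is_derive x 1 (erf \o (fun x => (x - y) / r))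
      (2 / Num.sqrt pi * gauss_fun ((x - y) / r) * r^-1) by exact: is_derive1_comp.
  have d2 : is_derive x 1 (gauss_fun \o (fun x => (x - y) / r))
      (- 2 * ((x - y) / r) * gauss_fun ((x - y) / r) * r^-1) by exact: is_derive1_comp.
  apply: is_derive_eq; rewrite normal_pdf_gauss_fun // -/r /GRing.scale /=; field.
  by rewrite (gt_eqF sp0) (gt_eqF r0).
rewrite (@ge0_continuous_FTC2y R _ F 0 (y / 2)).
- rewrite -EFinB /F sub0r mulNr erfN /gauss_fun sqrrN; congr EFin; field.
  by rewrite (gt_eqF sp0).
- by move=> x x0; rewrite mulr_ge0 ?normal_pdf_ge0.
- apply: continuous_subspaceT => x; apply: cvgM; last exact: cvg_id.
  by apply: continuous_normal_pdf; rewrite gt_eqF.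
- have -> : y / 2 = y / 2 * 1 - r / (2 * Num.sqrt pi) * 0 by ring.
  apply: cvgB; apply: cvgMl_tmp.
    exact: (cvg_comp _ _ (normal_scale_affine_cvgy y s0) erf_cvgy).
  exact: (cvg_comp _ _ (normal_scale_affine_cvgy y s0) cvg_gauss_fun).
- by move=> x _; have [] := dF x.
- apply/cvg_at_right_filter.
  by apply: differentiable_continuous; apply/derivable1_diffP; have [] := dF 0.
- by move=> x _; rewrite derive1E; have [] := dF x.
Qed.

Lemma ge0_integral_half_lines (f : R -> R) : (forall x, 0 <= f x) -> continuous f ->
  (\int[mu]_x (f x)%:E =
   \int[mu]_(x in `[0%R, +oo[) (f x)%:E + \int[mu]_(x in `[0%R, +oo[) (f (- x))%:E)%E.
Proof.
move=> f0 cf; have mf : measurable_fun [set: R] f by exact: continuous_measurable_fun.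
rewrite -(setUv `[0%R, +oo[) ge0_integral_setU//= ; last 4 first.
- exact: measurableC.
- by apply/measurable_EFinP; rewrite setUv.
- by move=> x _; rewrite lee_fin.
- exact/disj_setPCl.
congr (_ + _)%E; rewrite setCitvr integral_itv_bndo_bndc.
  by rewrite -{1}oppr0 ge0_integration_by_substitutionNy//; exact: continuous_subspaceT.
exact/measurable_EFinP/measurable_funTS.
Qed.

Lemma normal_pdfN y s x : 0 < s -> normal_pdf y s (- x) = normal_pdf (- y) s x.
Proof.
move=> s0; rewrite !normal_pdf_gauss_fun // -[in LHS]opprD mulNr opprK.
by rewrite /gauss_fun sqrrN.
Qed.

Lemma integral_norm_normal_pdf y s : 0 < s ->
  (\int[mu]_x (normal_pdf y s x * `|x|)%:E)%E =
  (y * erf (y / normal_scale s) +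
   normal_scale s / Num.sqrt pi * gauss_fun (y / normal_scale s))%:E.
Proof.
move=> s0; rewrite ge0_integral_half_lines; last 2 first.
- by move=> x; rewrite mulr_ge0 ?normal_pdf_ge0.
- move=> x; apply: cvgM; last exact: norm_continuous.
  by apply: continuous_normal_pdf; rewrite gt_eqF.
have -> : (\int[mu]_(x in `[0%R, +oo[) (normal_pdf y s x * `|x|)%:E)%E =
    (\int[mu]_(x in `[0%R, +oo[) (normal_pdf y s x * x)%:E)%E.
  by apply: eq_integral => x; rewrite inE /= in_itv /= andbT => x0; rewrite ger0_norm.
have -> : (\int[mu]_(x in `[0%R, +oo[) (normal_pdf y s (- x) * `|- x|)%:E)%E =
    (\int[mu]_(x in `[0%R, +oo[) (normal_pdf (- y) s x * x)%:E)%E.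
  apply: eq_integral => x; rewrite inE /= in_itv /= andbT => x0.
  by rewrite normrN ger0_norm // normal_pdfN.
rewrite !integral_id_normal_pdf_half_line // -EFinD !mulNr erfN /gauss_fun sqrrN.
congr EFin; field; rewrite !gt_eqF ?sqrtr_gt0 ?pi_gt0 //; exact: normal_scale_gt0.
Qed.

End normal_integrals.

(** * Exponential tilting and bounded expectations under a normal law *)

Section normal_expectation.
Context {R : realType}.
Notation mu := (@lebesgue_measure R).
Local Open Scope classical_set_scope.
Implicit Types (y s x : R).

(** Completing the square: (x - y)^2 + 4xy = (x + y)^2. *)
Lemma normal_pdf_tilt y s x : 0 < s ->
  normal_pdf y s x * expR (- (2 * y / s ^+ 2 * x)) = normal_pdf (- y) s x.
Proof.
move=> s0; rewrite !normal_pdf_gauss_fun // /gauss_fun -[LHS]mulrA -expRD; congr (_ * expR _).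
rewrite !expr_div_n normal_scale_sqr -mulr_natr; field.
by rewrite gt_eqF.
Qed.

Lemma integrable_norm_normal_pdf y s : 0 < s ->
  mu.-integrable setT (EFin \o (fun x => normal_pdf y s x * `|x|)).
Proof.
move=> s0; apply/integrableP; split.
  apply/measurable_EFinP; apply: measurable_funM; first exact: measurable_normal_pdf.
  exact: normr_measurable.
under eq_integral => x _.
  rewrite /= ger0_norm; last by rewrite mulr_ge0 ?normal_pdf_ge0.
  over.
by rewrite integral_norm_normal_pdf // ltry.
Qed.

Lemma integrable_normal_pdfM y s (g : R -> R) (M : R) :
  measurable_fun setT g -> (forall x, `|g x| <= M) ->
  mu.-integrable setT (EFin \o (fun x => normal_pdf y s x * g x)).
Proof.
move=> mg gM; have iM := integrableZl measurableT M (integrable_normal_pdf y s).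
apply: le_integrable iM => //.
  by apply/measurable_EFinP; apply: measurable_funM => //; exact: measurable_normal_pdf.
move=> x _ /=; rewrite lee_fin !normrM mulrC ler_wpM2r //.
by rewrite (le_trans (gM x)) // ler_norm.
Qed.

Lemma normr_Rintegral_normal_pdfM y s (g : R -> R) (M : R) :
  measurable_fun setT g -> (forall x, `|g x| <= M) ->
  `|\int[mu]_x (normal_pdf y s x * g x)| <= M.
Proof.
move=> mg gM; have i := integrable_normal_pdfM y s mg gM.
apply: le_trans (le_normr_Rintegral measurableT i) _.
have M1 : M = \int[mu]_x (M * normal_pdf y s x).
  rewrite RintegralZl //; last exact: integrable_normal_pdf.
  by rewrite /Rintegral integral_normal_pdf mulr1.
rewrite [leRHS]M1; apply: le_Rintegral => //.
- by apply/integrable_norm : i.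
- exact (integrableZl measurableT M (integrable_normal_pdf y s)).
- move=> x _ /=; rewrite normrM mulrC (ger0_norm (normal_pdf_ge0 y s x)) ler_wpM2r //.
  exact: normal_pdf_ge0.
Qed.

Lemma measurable_expR_pos_part (l : R) :
  measurable_fun setT (fun x => expR (- (l * Num.max x 0))).
Proof.
apply: measurableT_comp => //; apply: measurableT_comp => //.
apply: measurable_funM => //; exact: measurable_maxr.
Qed.

Lemma expR_pos_part_le1 (l x : R) : 0 <= l -> 0 <= expR (- (l * Num.max x 0)) <= 1.
Proof.
by move=> l0; rewrite expR_ge0 -expR0 ler_expR oppr_le0 mulr_ge0 // le_max lexx orbT.
Qed.

(** The integrand vanishes for x < 0. For x >= 0 the tilt reflects the law, which leaves P(N >= 0) -
    P(N <= 0) = E sgn N for N of mean y and deviation s. *)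
Lemma Rintegral_normal_pdf_tilted_sign y s : 0 < s ->
  \int[mu]_x (normal_pdf y s x * (1 - expR (- (2 * y / s ^+ 2 * Num.max x 0)))) =
  erf (y / normal_scale s).
Proof.
move=> s0; pose D : set R := `[0%R, +oo[.
rewrite [LHS](_ : _ = \int[mu]_(x in D) (normal_pdf y s x - normal_pdf (- y) s x)).
  have mD : measurable D by exact: measurable_itv.
  have iD m : mu.-integrable D (EFin \o normal_pdf m s).
    exact: (@integrableS _ _ _ mu setT D _ measurableT mD (@subsetT _ _)
      (integrable_normal_pdf m s)).
  rewrite RintegralB //.
  rewrite /Rintegral !integral_normal_pdf_half_line //= mulNr erfN; by field.
rewrite [RHS]Rintegral_mkcond; apply: eq_Rintegral => x _.
rewrite patchE; case: ifPn => [|/negP]; rewrite inE /D /= in_itv /= andbT => x0.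
  by rewrite max_l // mulrBr mulr1 normal_pdf_tilt.
by rewrite max_r ?mulr0 ?oppr0 ?expR0 ?subrr ?mulr0 // leNgt; apply/negP => /ltW.
Qed.

End normal_expectation.

(** * The Gaussian evaluation of u *)

Section gaussian_side.
Context {R : realType}.
Notation mu := (@lebesgue_measure R).
Local Open Scope classical_set_scope.
Implicit Types (eps x y : R) (n : nat).

Definition log_odds eps := ln ((1 + eps) / (1 - eps)).

Lemma log_odds_ge eps : 0 < eps < 1 -> 2 * eps / (1 + eps) <= log_odds eps.
Proof.
move=> /andP[e0 e1]; have d0 : 0 < 1 + eps by lra.
have c0 : 0 < 1 - eps by lra.
rewrite /log_odds -[(1 + eps) / (1 - eps)]invrK invf_div lnV ?posrE ?divr_gt0 //.
have -> : (1 - eps) / (1 + eps) = 1 + - (2 * eps / (1 + eps)) by field; lra.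
rewrite lerNr le_ln1Dx // ltrN2 ltr_pdivrMr //; lra.
Qed.

Lemma log_odds_le eps : 0 < eps < 1 -> log_odds eps <= 2 * eps / (1 - eps).
Proof.
move=> /andP[e0 e1]; have d0 : 0 < 1 - eps by lra.
have -> : log_odds eps = ln (1 + 2 * eps / (1 - eps)).
  by congr ln; field; lra.
by apply: le_ln1Dx; rewrite (lt_le_trans _ (_ : 0 <= _)) ?ltrN10 // divr_ge0 ?ltW //; lra.
Qed.

Lemma log_odds_gt0 eps : 0 < eps < 1 -> 0 < log_odds eps.
Proof.
move=> e01; apply: lt_le_trans (log_odds_ge e01).
by move: e01 => /andP[e0 e1]; rewrite divr_gt0 //; lra.
Qed.

(** The difference is exp(-ax) (1 - exp(-(b - a)x)), at most exp(-ax) (b - a) x, and a x exp(-ax) <=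
    1. *)
Lemma expRN_sub_le (a b x : R) : 0 < a -> a <= b -> 0 <= x ->
  0 <= expR (- (a * x)) - expR (- (b * x)) <= (b - a) / a.
Proof.
move=> a0 ab x0; rewrite subr_ge0 ler_expR lerN2 ler_wpM2r //=.
have -> : - (b * x) = - (a * x) + - ((b - a) * x) by ring.
rewrite expRD -{1}[expR (- (a * x))]mulr1 -mulrBr.
have e1 : 1 - expR (- ((b - a) * x)) <= (b - a) * x.
  by have := expR_ge1Dx (- ((b - a) * x)); lra.
have e2 : expR (- (a * x)) * (a * x) <= 1.
  rewrite expRN mulrC ler_pdivrMr ?expR_gt0 // mul1r.
  by have := expR_ge1Dx (a * x); lra.
apply: le_trans (ler_wpM2l (expR_ge0 _) e1) _.
rewrite ler_pdivlMr // (_ : _ * a = (b - a) * (expR (- (a * x)) * (a * x))); last by ring.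
by rewrite -[leRHS]mulr1 ler_wpM2l // subr_ge0.
Qed.

(** For eps <= 1/2 both rates are at least eps and they differ by at most 4 eps^2, so [expRN_sub_le]
    gives 4 eps. For larger eps, both exponentials lie in [0, 1]. The factor eps absorbs the 1/eps
    in front of the exponential in [varphi]. *)
Lemma exp_rates_close eps x : 0 < eps < 1 -> 0 <= x ->
  `|expR (- (log_odds eps * x)) - expR (- (2 * eps / kappa eps * x))| <= 4 * eps.
Proof.
move=> e01 x0; have /andP[e0 e1] := e01.
have k0 : 0 < kappa eps by rewrite /kappa; nra.
have l0 := log_odds_gt0 e01; have m0 : 0 < 2 * eps / kappa eps by rewrite divr_gt0 //; lra.
have [e2|e2] := leP eps 2^-1; last first.
  have /andP[a0 a1] : 0 <= expR (- (log_odds eps * x)) <= 1.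
    by rewrite expR_ge0 -expR0 ler_expR oppr_le0 mulr_ge0 // ltW.
  have /andP[c0 c1] : 0 <= expR (- (2 * eps / kappa eps * x)) <= 1.
    by rewrite expR_ge0 /= -[leRHS]expR0 ler_expR oppr_le0 mulr_ge0 // (ltW m0).
  by rewrite ler_norml; lra.
have lge := log_odds_ge e01; have lle := log_odds_le e01.
have le : eps <= 2 * eps / (1 + eps) by rewrite ler_pdivlMr; nra.
have ub : 2 * eps / (1 - eps) <= 2 * eps + 4 * eps ^+ 2 by rewrite ler_pdivrMr; nra.
have mlb : 2 * eps <= 2 * eps / kappa eps by rewrite ler_pdivlMr // /kappa; nra.
have mub : 2 * eps / kappa eps <= 2 * eps / (1 + eps) + 4 * eps ^+ 2.
  have -> : 2 * eps / kappa eps = 2 * eps / (1 + eps) + 2 * eps ^+ 2 / kappa eps.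
    by rewrite /kappa in k0 *; field; rewrite !gt_eqF //; lra.
  have eps2 : eps ^+ 2 <= 4^-1 by nra.
  have := mulr_ge0 (sqr_ge0 eps) (_ : 0 <= 4^-1 - eps ^+ 2); rewrite subr_ge0 => /(_ eps2).
  by rewrite lerD2l ler_pdivrMr // /kappa; nra.
have ratio (a b : R) : eps <= a -> b - a <= 4 * eps ^+ 2 -> (b - a) / a <= 4 * eps.
  by move=> ae ba; rewrite ler_pdivrMr; nra.
have [lm|ml] := leP (log_odds eps) (2 * eps / kappa eps).
  have /andP[d0 d1] := expRN_sub_le l0 lm x0.
  by rewrite ger0_norm // (le_trans d1) // ratio //; lra.
have /andP[d0 d1] := expRN_sub_le m0 (ltW ml) x0.
by rewrite distrC ger0_norm // (le_trans d1) // ratio //; lra.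
Qed.

Lemma Phi_normal_pdf eps x y t s : 0 < s -> s ^+ 2 = - (kappa eps * t) ->
  Phi eps (y - x) t = normal_pdf y s x.
Proof.
move=> s0 st; rewrite normal_pdfE ?gt_eqF // /Phi; congr (_^-1 * expR _).
  by congr Num.sqrt; rewrite st -[RHS]mulr_natr; ring.
have kt0 : kappa eps * t != 0 by rewrite -oppr_eq0 -st gt_eqF // exprn_gt0.
have := kt0; rewrite mulf_eq0 negb_or => /andP[k0 t0].
by rewrite st -[X in _ = _ / X]mulr_natr; field; rewrite t0.
Qed.

Lemma varphiE eps y : 0 < eps < 1 -> varphi eps (sigma0 eps) (b0 eps) y =
  `|y| - eps^-1 * (1 - expR (- (log_odds eps * Num.max y 0))).
Proof.
move=> e01; have l0 := log_odds_gt0 e01; have /andP[e0 e1] := e01.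
rewrite /varphi /b0 /sigma0 -/(log_odds eps) div1r; case: ifPn => [y0|].
  by rewrite ler0_norm // max_r // mulr0 oppr0 expR0 subrr mulr0 subr0.
rewrite -ltNge => y0; rewrite gtr0_norm // max_l ?ltW //.
have -> : 2 * eps * y / (2 * eps / log_odds eps) = log_odds eps * y.
  by field; rewrite !gt_eqF.
ring.
Qed.

(** E|N| for N normal of mean n eps and variance n [kappa eps], the drift and variance of the n-step
    walk. *)
Definition gauss_abs_mean eps n : R := n%:R * eps * erf (eps * Num.sqrt (n%:R / (2 * kappa eps)))
  + Num.sqrt (2 * kappa eps * n%:R / pi) * expR (- (n%:R * eps ^+ 2 / (2 * kappa eps))).

Section fixed_horizon.
Variables (eps : R) (n : nat).
Hypotheses (e01 : 0 < eps < 1) (n0 : (0 < n)%N).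

Let k0 : 0 < kappa eps.
Proof. by move: e01 => /andP[? ?]; rewrite /kappa; nra. Qed.

Let nR0 : 0 < n%:R :> R. Proof. by rewrite ltr0n. Qed.

Let s := Num.sqrt (kappa eps * n%:R).

Let s0 : 0 < s. Proof. by rewrite sqrtr_gt0 mulr_gt0. Qed.

Let s2 : s ^+ 2 = - (kappa eps * - n%:R).
Proof. by rewrite sqr_sqrtr ?mulrN ?opprK // mulr_ge0 ?ltW. Qed.

Let s2E : s ^+ 2 = kappa eps * n%:R. Proof. by rewrite s2 mulrN opprK. Qed.

Let scaleE : normal_scale s = Num.sqrt (2 * kappa eps * n%:R).
Proof. by rewrite /normal_scale s2E -mulr_natl mulrA. Qed.

Let drift_scale : n%:R * eps / normal_scale s = eps * Num.sqrt (n%:R / (2 * kappa eps)).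
Proof.
have -> : n%:R / (2 * kappa eps) = n%:R ^+ 2 / (2 * kappa eps * n%:R).
  by field; rewrite !gt_eqF.
rewrite sqrtrM ?sqr_ge0 // sqrtrV ?sqrtr_sqr ?ger0_norm ?scaleE //; first by ring.
by rewrite !mulr_ge0 // ltW.
Qed.

Let drift_gauss : gauss_fun (n%:R * eps / normal_scale s) =
  expR (- (n%:R * eps ^+ 2 / (2 * kappa eps))).
Proof.
rewrite /gauss_fun expr_div_n normal_scale_sqr s2E -mulr_natr; congr (expR (- _)).
by field; rewrite !gt_eqF.
Qed.

Lemma Rintegral_Phi_norm :
  \int[mu]_x (Phi eps (n%:R * eps - x) (- n%:R) * `|x|) = gauss_abs_mean eps n.
Proof.
under eq_Rintegral do rewrite (Phi_normal_pdf _ _ s0 s2).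
rewrite /Rintegral integral_norm_normal_pdf // drift_gauss drift_scale /gauss_abs_mean scaleE.
congr (_ + _ * _); rewrite -sqrtrV ?pi_ge0 // -sqrtrM //.
by rewrite !mulr_ge0 // ltW.
Qed.

Lemma varphi_hat_bound :
  `| varphi_hat eps (sigma0 eps) (b0 eps) (n%:R * eps) (- n%:R) -
     (gauss_abs_mean eps n - eps^-1 * erf (eps * Num.sqrt (n%:R / (2 * kappa eps)))) | <= 4.
Proof.
have /andP[e0 e1] := e01; set y := n%:R * eps.
(* The rate 2 eps / kappa is the one that reflects this normal law, whatever n is. *)
have lam : 2 * y / s ^+ 2 = 2 * eps / kappa eps.
  by rewrite s2E /y; field; rewrite !gt_eqF.
pose H l x : R := expR (- (l * Num.max x 0)).
have m0 : 0 <= 2 * eps / kappa eps by rewrite divr_ge0 ?ltW // mulr_gt0.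
have Hclose x : `|eps^-1 * (H (log_odds eps) x - H (2 * eps / kappa eps) x)| <= 4.
  rewrite normrM gtr0_norm ?invr_gt0 // mulrC ler_pdivrMr //.
  by apply: exp_rates_close => //; rewrite le_max lexx orbT.
(* Three expectations: the absolute value, the tilted sign at the reflecting rate, and the cost of
   changing the rate, whose integrand is at most 4 times the density. *)
have -> : varphi_hat eps (sigma0 eps) (b0 eps) y (- n%:R) =
    \int[mu]_x (normal_pdf y s x * `|x|) -
    (eps^-1 * \int[mu]_x (normal_pdf y s x * (1 - H (2 * eps / kappa eps) x)) -
     \int[mu]_x (normal_pdf y s x * (eps^-1 * (H (log_odds eps) x - H (2 * eps / kappa eps) x)))).
  have mH l : measurable_fun setT (H l) by exact: measurable_expR_pos_part.
  have H1 l x : 0 <= l -> `|1 - H l x| <= 1.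
    by move=> l0; have /andP[? ?] := expR_pos_part_le1 x l0; rewrite ler_norml /H; lra.
  have i1 := integrable_norm_normal_pdf y s0.
  have i2 := @integrable_normal_pdfM R y s (fun x => 1 - H (2 * eps / kappa eps) x) 1
    (measurable_funB (measurable_cst _) (mH _)) (fun x => H1 _ x m0).
  have i3 := @integrable_normal_pdfM R y s
    (fun x => eps^-1 * (H (log_odds eps) x - H (2 * eps / kappa eps) x)) 4
    (measurable_funM (measurable_cst _) (measurable_funB (mH _) (mH _))) Hclose.
  have i2' : mu.-integrable setT (EFin \o (fun x => eps^-1 *
      (normal_pdf y s x * (1 - H (2 * eps / kappa eps) x)))).
    exact (integrableZl measurableT eps^-1 i2).
  rewrite -RintegralZl // -RintegralB // -RintegralB //; last exact: (integrableB _ i2' i3).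
  apply: eq_Rintegral => x _; rewrite (Phi_normal_pdf _ _ s0 s2) varphiE // -/(H _ _); ring.
rewrite -Rintegral_Phi_norm.
under [X in _ - (X - _)]eq_Rintegral do rewrite (Phi_normal_pdf _ _ s0 s2).
have := Rintegral_normal_pdf_tilted_sign y s0; rewrite lam drift_scale => ->.
set A := \int[mu]_x _; set B := erf _.
rewrite (_ : _ - _ = \int[mu]_x (normal_pdf y s x *
  (eps^-1 * (H (log_odds eps) x - H (2 * eps / kappa eps) x)))); last by ring.
apply: normr_Rintegral_normal_pdfM.
  apply: measurable_funM => //; apply: measurable_funB; exact: measurable_expR_pos_part.
exact: Hclose.
Qed.

End fixed_horizon.

End gaussian_side.

(** * Comparison of the walk with the Gaussian law *)

Section sign_poly_versus_erf.
Context {R : realType}.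
Local Open Scope classical_set_scope.
Implicit Types (eps x t : R) (m n : nat).

(** The induction telescopes: 2(m + 1) c_(m+1) = (2m + 1) c_m for the central weights, and the terms
    in x^2 recombine through x^2 = 1 - (1 - x^2). *)
Lemma is_derive_sign_poly m x :
  is_derive x 1 (sign_poly m) (sign_slope m * (1 - x ^+ 2) ^+ m).
Proof.
elim: m => [|m IHm].
  rewrite (_ : sign_poly 0 = id); last by apply/funext => y; rewrite sign_poly0.
  by apply: is_derive_eq; rewrite sign_slope0 expr0 mulr1.
have dk : is_derive x 1 (fun x : R => 1 - x ^+ 2) (- (2 * x)).
  by apply: is_derive_eq; rewrite /GRing.scale /=; ring.
have dX : is_derive x 1 (fun x : R => (1 - x ^+ 2) ^+ m.+1)
    (m.+1%:R * (1 - x ^+ 2) ^+ m * - (2 * x)).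
  by have := is_deriveX m.+1 dk; rewrite exprfctE.
rewrite (_ : sign_poly m.+1 = (fun x => sign_poly m x +
    central_weight m.+1 * (x * (1 - x ^+ 2) ^+ m.+1))); last first.
  by apply/funext => y; rewrite sign_polyS.
apply: is_derive_eq; rewrite /GRing.scale /= sign_slopeE /sign_slope doubleS.
rewrite ![(1 - x ^+ 2) ^+ m.+1]exprS -[m.*2.+3]addn3 -[m.*2.+2]addn2 -[m.+1]addn1.
by rewrite -muln2 !natrD natrM; ring.
Qed.

Lemma sign_poly_at0 m : sign_poly m 0 = 0 :> R.
Proof. by rewrite /sign_poly big1 // => j _; rewrite mul0r mulr0. Qed.

Lemma sign_poly_at1 m : sign_poly m 1 = 1 :> R.
Proof.
elim: m => [|m IHm]; first by rewrite sign_poly0.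
by rewrite sign_polyS IHm expr1n subrr exprS mul0r !mulr0 addr0.
Qed.

Lemma sign_poly_le1 m x : 0 <= x <= 1 -> sign_poly m x <= 1.
Proof.
move=> /andP[x0 x1]; rewrite -(sign_poly_at1 m).
apply: (is_derive_ge0_le x1 (fun y _ => is_derive_sign_poly m y)) => y /andP[xy y1].
by rewrite mulr_ge0 ?sign_slope_ge0 // exprn_ge0 // subr_ge0 expr_le1 // (le_trans x0).
Qed.

(** Both sides vanish at 0, and their derivatives compare by (1 - y^2)^m <= exp(-m y^2). *)
Lemma sign_poly_ub m x (a := Num.sqrt m%:R) : (0 < m)%N -> 0 <= x <= 1 ->
  sign_poly m x <= sign_slope m * Num.sqrt pi / (2 * a) * erf (a * x).
Proof.
move=> m0 /andP[x0 x1]; rewrite -subr_ge0.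
have a0 : 0 < a by rewrite sqrtr_gt0 ltr0n.
have sp0 : 0 < Num.sqrt pi :> R by rewrite sqrtr_gt0 pi_gt0.
set A := _ / (2 * a).
rewrite -[leLHS](_ : A * erf (a * 0) - sign_poly m 0 = 0); last first.
  by rewrite mulr0 erf0 sign_poly_at0 mulr0 subr0.
have d (y : R) : is_derive y 1 (fun x => A * erf (a * x) - sign_poly m x)
    (sign_slope m * (gauss_fun (a * y) - (1 - y ^+ 2) ^+ m)).
  have d1 : is_derive y 1 (erf \o (fun x => a * x))
      (2 / Num.sqrt pi * gauss_fun (a * y) * a).
    by apply: is_derive1_comp; apply: is_derive_eq; rewrite /GRing.scale /=; ring.
  have d2 := is_derive_sign_poly m y.
  apply: is_derive_eq; rewrite /GRing.scale /= /A; field.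
  by rewrite (gt_eqF sp0) (gt_eqF a0).
apply: (is_derive_ge0_le x0 (fun y _ => d y)) => y /andP[y0 yx].
rewrite mulr_ge0 ?sign_slope_ge0 // subr_ge0 /gauss_fun exprMn sqr_sqrtr //.
rewrite -(mulrN m%:R) expRM_natl.
have y2 : 0 <= 1 - y ^+ 2 by rewrite subr_ge0 expr_le1 // (le_trans yx).
rewrite lerXn2r ?nnegrE ?expR_ge0 //.
by have := expR_ge1Dx (- y ^+ 2); lra.
Qed.

(** For x = t / sqrt(1 + t^2), 1 - x^2 = (1 + t^2)^-1 and dx/dt = (1 + t^2)^(-3/2). The t-derivative
    of the right-hand side is thus the slope times (1 + t^2)^-(m + 3/2), which dominates a Gaussian
    of rate m + 3/2. *)
Lemma sign_poly_lb m t (q := Num.sqrt (m%:R + 3 / 2)) : 0 <= t ->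
  sign_slope m * Num.sqrt pi / (2 * q) * erf (q * t) <=
  sign_poly m (t / Num.sqrt (1 + t ^+ 2)).
Proof.
move=> t0; rewrite -subr_ge0.
have q0 : 0 < q by rewrite sqrtr_gt0 ltr_wpDl // divr_gt0.
have sp0 : 0 < Num.sqrt pi :> R by rewrite sqrtr_gt0 pi_gt0.
set A := _ / (2 * q); pose r x : R := Num.sqrt (1 + x ^+ 2).
rewrite -[leLHS](_ : sign_poly m (0 / r 0) - A * erf (q * 0) = 0); last first.
  by rewrite mulr0 erf0 mul0r sign_poly_at0 mulr0 subr0.
have r2 (y : R) : r y ^+ 2 = 1 + y ^+ 2 by rewrite sqr_sqrtr // addr_ge0 // sqr_ge0.
have r0 (y : R) : 0 < r y by rewrite sqrtr_gt0 ltr_wpDr // sqr_ge0.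
have d (y : R) : is_derive y 1 (fun x => sign_poly m (x / r x) - A * erf (q * x))
    (sign_slope m * (r y ^- (m.*2 + 3) - gauss_fun (q * y))).
  have d1 : is_derive y 1 (erf \o (fun x => q * x))
      (2 / Num.sqrt pi * gauss_fun (q * y) * q).
    by apply: is_derive1_comp; apply: is_derive_eq; rewrite /GRing.scale /=; ring.
  have dr : is_derive y 1 r (y / r y).
    have rp : 0 < 1 + y ^+ 2 by rewrite ltr_wpDr // sqr_ge0.
    have dd : is_derive y 1 (fun x : R => 1 + x ^+ 2) (2 * y).
      by apply: is_derive_eq; rewrite /GRing.scale /=; ring.
    have := @is_derive1_comp R Num.sqrt (fun x : R => 1 + x ^+ 2) y _ _ (is_derive1_sqrt rp) dd.
    rewrite (_ : _ * _ = y / r y) // /r; field.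
    by rewrite gt_eqF // r0.
  have ry : r y != 0 by rewrite gt_eqF.
  have dx : is_derive y 1 (fun x => x / r x) (r y ^- 3).
    have dV := is_deriveV ry dr.
    apply: is_derive_eq; rewrite /GRing.scale /=.
    rewrite (_ : r y ^- 3 = (r y ^+ 2 - y ^+ 2) / r y ^+ 3); last first.
      by rewrite r2 addrK div1r.
    by field.
  have dP := @is_derive1_comp R (sign_poly m) (fun x => x / r x) y _ _
    (is_derive_sign_poly m (y / r y)) dx.
  apply: is_derive_eq; rewrite /GRing.scale /=.
  have -> : 1 - (y / r y) ^+ 2 = (r y ^+ 2)^-1.
    rewrite expr_div_n -[X in _ - X / _](addrK 1) [y ^+ 2 + 1]addrC -r2; field.
    by [].
  have <- : (r y ^+ 2)^-1 ^+ m * r y ^- 3 = r y ^- (m.*2 + 3).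
    by rewrite exprVn -exprM -invfM -exprD mul2n.
  move: (_ ^-1 ^+ m) => z; rewrite /A; field.
  by rewrite ry (gt_eqF sp0) (gt_eqF q0).
apply: (is_derive_ge0_le t0 (fun y _ => d y)) => y /andP[y0 yt].
rewrite mulr_ge0 ?sign_slope_ge0 // subr_ge0.
have : r y <= expR (y ^+ 2 / 2).
  rewrite -(@ler_pXn2r _ 2) ?nnegrE ?expR_ge0 ?(ltW (r0 y)) // r2 -expRM_natl.
  by apply: le_trans (expR_ge1Dx _) _; rewrite ler_expR; lra.
rewrite /gauss_fun expRN => rle; rewrite lef_pV2 ?posrE ?expR_gt0 ?exprn_gt0 //.
apply: le_trans (lerXn2r (m.*2 + 3) _ _ rle) _; rewrite ?nnegrE ?expR_ge0 ?(ltW (r0 y)) //.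
rewrite -expRM_natl ler_expR exprMn sqr_sqrtr ?addr_ge0 ?divr_ge0 //.
by rewrite natrD -muln2 natrM; lra.
Qed.

(** [sign_poly_ub] at x = 1, where the polynomial is 1 and [erf] is at most 1. *)
Lemma sign_slope_lb m : (0 < m)%N -> 2 * Num.sqrt m%:R / Num.sqrt pi <= sign_slope m :> R.
Proof.
move=> m0; have sp0 : 0 < Num.sqrt pi :> R by rewrite sqrtr_gt0 pi_gt0.
have a0 : 0 < Num.sqrt m%:R :> R by rewrite sqrtr_gt0 ltr0n.
have := @sign_poly_ub m 1 m0; rewrite ler01 lexx sign_poly_at1 => /(_ isT) /le_trans P1.
have {P1} : 1 <= sign_slope m * Num.sqrt pi / (2 * Num.sqrt m%:R) :> R.
  apply: P1; rewrite ler_piMr ?erf_le1 // divr_ge0 ?mulr_ge0 ?sign_slope_ge0 ?(ltW sp0) //.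
by rewrite ler_pdivlMr ?mulr_gt0 // mul1r ler_pdivrMr.
Qed.

Lemma sign_slope_gt0 m : 0 < sign_slope m :> R.
Proof.
rewrite mulr_gt0 // ?ltr0n // /central_weight divr_gt0 ?exprn_gt0 // ltr0n bin_gt0.
by rewrite -addnn leq_addr.
Qed.

(** Letting t tend to infinity in [sign_poly_lb]: [erf] tends to 1 while the polynomial stays at
    most 1. With [sign_slope_lb] this is a two-sided Wallis estimate. *)
Lemma sign_slope_ub m : sign_slope m <= 2 * Num.sqrt (m%:R + 3 / 2) / Num.sqrt pi :> R.
Proof.
set q := Num.sqrt _; have q0 : 0 < q by rewrite sqrtr_gt0 ltr_wpDl // divr_gt0.
have sp0 : 0 < Num.sqrt pi :> R by rewrite sqrtr_gt0 pi_gt0.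
have c0 : 0 < sign_slope m * Num.sqrt pi / (2 * q) :> R.
  by apply: divr_gt0; apply: mulr_gt0 => //; exact: sign_slope_gt0.
rewrite ler_pdivlMr // -[leRHS]mul1r -ler_pdivrMr ?mulr_gt0 //.
rewrite -[leLHS]invrK invf_le1 ?invr_gt0 //.
rewrite -[leLHS](cvg_lim _ (@erf_cvgy R)) //; apply: limr_le; first exact: cvgP (@erf_cvgy R).
near=> y; have y0 : 0 <= y by near: y; exact: nbhs_pinfty_ge.
rewrite -[leRHS]mul1r ler_pdivlMr // mulrC.
have := @sign_poly_lb m (y / q) (divr_ge0 y0 (ltW q0)).
rewrite -/q (_ : q * (y / q) = y); last by field; rewrite gt_eqF.
move=> /le_trans; apply.
set t := y / q; have t0 : 0 <= t by rewrite divr_ge0 // ltW.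
have t1 : 0 < 1 + t ^+ 2 by rewrite ltr_wpDr // sqr_ge0.
apply: sign_poly_le1; rewrite divr_ge0 //= ler_pdivrMr ?sqrtr_gt0 // mul1r.
by rewrite -[leLHS]ger0_norm // -sqrtr_sqr ler_sqrt //; lra.
Unshelve. all: by end_near. Qed.

End sign_poly_versus_erf.

(** * Uniform bounds on the gap between walk and Gaussian means *)

Section numerical_comparison.
Context {R : realType}.
Implicit Types (eps x y : R) (m n : nat).

Lemma expRN_mul_le1 x : 0 <= x -> x * expR (- x) <= 1.
Proof.
move=> x0; rewrite expRN ler_pdivrMr ?expR_gt0 // mul1r.
by have := expR_ge1Dx x; lra.
Qed.

Lemma le_of_le_sqr x y : 0 <= y -> x ^+ 2 <= y ^+ 2 -> x <= y.
Proof. by move=> y0 xy; rewrite leNgt; apply/negP => yx; nra. Qed.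

Lemma le_sqrtr_self x : 1 <= x -> Num.sqrt x <= x.
Proof.
move=> x1; rewrite -[leRHS]ger0_norm ?(le_trans ler01) // -sqrtr_sqr ler_sqrt; nra.
Qed.

Section fixed_horizon.
Variables (eps : R) (n : nat).
Hypotheses (e01 : 0 < eps < 1) (n0 : (0 < n)%N).

Let m := n.-1./2.
Let k := kappa eps.
(** The mean n eps over the scale sqrt(2 n k), so that [erf z] is E sgn N. *)
Let z := eps * Num.sqrt (n%:R / (2 * k)).
Let P := sign_poly m eps.

Let e0 : 0 < eps. Proof. by case/andP: e01. Qed.
Let e1 : eps < 1. Proof. by case/andP: e01. Qed.
Let k0 : 0 < k. Proof. by have := e0; have := e1; rewrite /k /kappa; nra. Qed.
Let k1 : k < 1. Proof. by rewrite /k /kappa ltrBlDr ltrDl exprn_gt0. Qed.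
Let nR0 : 0 < n%:R :> R. Proof. by rewrite ltr0n. Qed.

Let n_lb : m%:R * 2 + 1 <= n%:R :> R.
Proof.
rewrite -natrM natr1 ler_nat muln2 /m; case: n n0 => // n' _ /=.
by rewrite ltnS -{2}[n']odd_double_half leq_addl.
Qed.

Let n_ub : n%:R <= m%:R * 2 + 2 :> R.
Proof.
rewrite -natrM -natrD ler_nat muln2 /m; case: n n0 => // n' _ /=.
by rewrite -{1}[n']odd_double_half addn2 -addSn ltnS; case: odd.
Qed.

Let z0 : 0 <= z. Proof. by rewrite mulr_ge0 ?sqrtr_ge0 // ltW. Qed.

Let P01 : 0 <= P <= 1.
Proof.
apply/andP; split; last by apply: sign_poly_le1; rewrite !ltW.
apply: sumr_ge0 => j _; rewrite mulr_ge0 ?divr_ge0 ?exprn_ge0 // mulr_ge0 ?exprn_ge0 ?ltW //.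
Qed.

(** With a = sqrt m and q = sqrt(m + 3/2), the slope bounds give (a / q) erf z <= P <= (q / a) erf
    z, and both ratios are within 3/(2m) of 1. The arguments of [erf] compare because 2m + 1 <= n <=
    2m + 2. *)
Lemma sign_poly_erf_relative : (0 < m)%N -> `|P - erf z| <= 3 / 2 / m%:R * erf z.
Proof.
move=> m0; have mR1 : 1 <= m%:R :> R by rewrite ler1n.
have sp0 : 0 < Num.sqrt pi :> R by rewrite sqrtr_gt0 pi_gt0.
have ez0 := erf_ge0 z0.
set a := Num.sqrt (m%:R : R); set q := Num.sqrt (m%:R + 3 / 2 : R).
have a0 : 0 < a by rewrite sqrtr_gt0; lra.
have q0 : 0 < q by rewrite sqrtr_gt0; lra.
have nk : 0 <= n%:R / (2 * k) by rewrite divr_ge0 // mulr_ge0 // ltW.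
have a2 : a ^+ 2 = m%:R by rewrite sqr_sqrtr; lra.
have q2 : q ^+ 2 = m%:R + 3 / 2 by rewrite sqr_sqrtr; lra.
have ub : P <= q / a * erf z.
  have e01' : 0 <= eps <= 1 by rewrite !ltW.
  apply: le_trans (sign_poly_ub m0 e01') _.
  have c_ub := @sign_slope_ub R m.
  apply: ler_pM.
  - by apply: divr_ge0; apply: mulr_ge0; rewrite ?sqrtr_ge0 ?sign_slope_ge0.
  - by apply/erf_ge0/mulr_ge0; rewrite ?sqrtr_ge0 ?(ltW e0).
  - rewrite ler_pdivrMr ?mulr_gt0 // (_ : q / a * (2 * a) = 2 * q); last first.
      by field; rewrite gt_eqF.
    by rewrite -ler_pdivlMr.
  - apply: le_erf; rewrite mulrC /z ler_pM2l // ler_sqrt //.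
    rewrite ler_pdivlMr ?mulr_gt0 //.
    by have := ler_wpM2l (ler0n R m) (ltW k1); have := n_lb; lra.
have lb : a / q * erf z <= P.
  (* The solution of t / sqrt(1 + t^2) = eps. *)
  set t := eps / Num.sqrt k.
  have sk0 : 0 < Num.sqrt k by rewrite sqrtr_gt0.
  have t0 : 0 <= t by rewrite divr_ge0 ?ltW.
  have := @sign_poly_lb R m t t0.
  have -> : t / Num.sqrt (1 + t ^+ 2) = eps.
    have -> : 1 + t ^+ 2 = k^-1.
      by rewrite expr_div_n sqr_sqrtr ?ltW // /k /kappa; field; rewrite gt_eqF.
    by rewrite sqrtrV ?ltW // invrK divfK // gt_eqF.
  apply: le_trans; rewrite -/q; apply: ler_pM.
  - by rewrite divr_ge0 ?sqrtr_ge0.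
  - by [].
  - rewrite ler_pdivlMr ?mulr_gt0 // (_ : a / q * (2 * q) = 2 * a); last first.
      by field; rewrite gt_eqF.
    by rewrite -ler_pdivrMr // sign_slope_lb.
  apply: le_erf; rewrite /z /t mulrCA ler_pM2l // /q -(sqrtrV (ltW k0)).
  have mq : 0 < m%:R + 3 / 2 :> R by lra.
  rewrite -(sqrtrM _ (ltW mq)).
  have mk : 0 <= (m%:R + 3 / 2) / k by rewrite divr_ge0 ?(ltW mq) ?(ltW k0).
  rewrite ler_sqrt //.
  by rewrite invfM mulrA ler_pM2r ?invr_gt0 // ; have := n_ub; lra.
have qa : q / a <= 1 + 3 / 2 / m%:R.
  rewrite ler_pdivrMr //; have : 0 <= 3 / 2 / m%:R :> R by rewrite divr_ge0.
  have : m%:R * (3 / 2 / m%:R) = 3 / 2 :> R by field; rewrite gt_eqF; lra.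
  move: (3 / 2 / m%:R) => d dm d0.
  apply: le_of_le_sqr; first by rewrite mulr_ge0 ?addr_ge0 ?(ltW a0).
  by rewrite q2 exprMn a2; nra.
have aq : 1 - 3 / 2 / m%:R <= a / q.
  have [s0|s0] := leP (1 - 3 / 2 / m%:R : R) 0.
    by rewrite (le_trans s0) ?divr_ge0 ?(ltW a0) ?(ltW q0).
  rewrite ler_pdivlMr //; have : 0 <= 3 / 2 / m%:R :> R by rewrite divr_ge0.
  have : m%:R * (3 / 2 / m%:R) = 3 / 2 :> R by field; rewrite gt_eqF; lra.
  move: (3 / 2 / m%:R) s0 => d s0 dm d0.
  apply: le_of_le_sqr; first exact: ltW.
  by rewrite a2 exprMn q2; nra.
have := ler_wpM2r ez0 qa; have := ler_wpM2r ez0 aq.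
by rewrite ler_norml; lra.
Qed.

(** n times 3/(2m) is at most 3 + 3/m <= 6 for m >= 1; for m = 0, n <= 2 suffices. *)
Lemma sign_poly_erf_scaled : n%:R * eps * `|P - erf z| <= 6.
Proof.
have ez0 := erf_ge0 z0; have ez1 := erf_le1 z; have /andP[P0 P1] := P01.
have ne : 0 <= n%:R * eps <= n%:R.
  by rewrite mulr_ge0 ?(ltW e0) //= ler_piMr // ltW.
case/andP: ne => ne0 ne1.
have d1 : `|P - erf z| <= 1 by rewrite ler_norml; lra.
have nub := n_ub; have [m0|m0] := posnP m.
  apply: le_trans (ler_pM ne0 (normr_ge0 _) ne1 d1) _.
  by move: nub; rewrite m0; lra.
have mR1 : 1 <= m%:R :> R by rewrite ler1n.
have m2 : 0 <= 3 / 2 / m%:R :> R by rewrite divr_ge0.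
have mE : m%:R * (3 / 2 / m%:R) = 3 / 2 :> R by field; rewrite gt_eqF; lra.
have := sign_poly_erf_relative m0; have := ler_wpM2l m2 ez1.
rewrite mulr1 => h1 h2; apply: le_trans (ler_pM ne0 (normr_ge0 _) ne1 (le_trans h2 h1)) _.
move: (3 / 2 / m%:R) m2 mE => d d0 dE.
have := ler_wpM2r d0 nub; nra.
Qed.

(** For small eps, erf z <= 2z is linear in eps. Its growth in n is at most linear in m and is
    absorbed by the relative error 3/(2m): (3/(2m)) 2 (8m/3) eps = 8 eps. For m = 0 the polynomial
    is eps itself. *)
Lemma sign_poly_erf_div : eps^-1 * `|P - erf z| <= 8.
Proof.
have ez0 := erf_ge0 z0; have ez1 := erf_le1 z; have /andP[P0 P1] := P01.
have d1 : `|P - erf z| <= 1 by rewrite ler_norml; lra.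
rewrite mulrC ler_pdivrMr //; have [eh|eh] := leP eps 2^-1; last by lra.
have kh : 3 / 4 <= k by have := e0; rewrite /k /kappa; nra.
have ezz := erf_le z0.
have nub := n_ub; have [m0|m0] := posnP m.
  have w2 : Num.sqrt (n%:R / (2 * k)) <= 2.
    apply: le_of_le_sqr => //; rewrite sqr_sqrtr ?divr_ge0 ?mulr_ge0 ?(ltW k0) //.
    by rewrite ler_pdivrMr ?mulr_gt0 //; move: nub; rewrite m0; lra.
  have := ler_wpM2l (ltW e0) w2; rewrite -/z => zz.
  have Pe : P = eps by rewrite /P m0 sign_poly0.
  by rewrite Pe ler_norml; have := e0; lra.
have mR1 : 1 <= m%:R :> R by rewrite ler1n.
have m2 : 0 <= 3 / 2 / m%:R :> R by rewrite divr_ge0.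
have mE : m%:R * (3 / 2 / m%:R) = 3 / 2 :> R by field; rewrite gt_eqF; lra.
apply: le_trans (sign_poly_erf_relative m0) _.
have w : Num.sqrt (n%:R / (2 * k)) <= 8 / 3 * m%:R.
  apply: le_trans (_ : Num.sqrt (8 / 3 * m%:R) <= _); last by apply: le_sqrtr_self; lra.
  have nk : 0 <= n%:R / (2 * k) by rewrite divr_ge0 // mulr_ge0 // ltW.
  rewrite ler_sqrt //.
  by rewrite ler_pdivrMr ?mulr_gt0 //; have := ler_wpM2l (ler0n R m) kh; lra.
have := ler_wpM2l (ltW e0) w; rewrite -/z => zz.
have zz2 : erf z <= 2 * (eps * (8 / 3 * m%:R)) by lra.
have := ler_wpM2l m2 zz2.
have -> : 3 / 2 / m%:R * (2 * (eps * (8 / 3 * m%:R))) = m%:R * (3 / 2 / m%:R) * (16 / 3 * eps).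
  ring.
by rewrite mE; lra.
Qed.

Let c := sign_slope m : R.
Let q := n%:R * eps ^+ 2.
(** The Gaussian counterpart of the slope [c]: the density term of E|N| is w sqrt k exp(-q / (2k)),
    against c k^(m+1) for the walk. *)
Let w : R := Num.sqrt (2 * n%:R / pi).

(** [w] and [c] both lie within 3 above 2 sqrt(m / pi), hence within 3 of each other; w <= n makes
    errors of order 1/n harmless after multiplication by [w]. *)
Let w_bounds : [/\ 2 * Num.sqrt m%:R / Num.sqrt pi <= w,
  w <= 2 * Num.sqrt m%:R / Num.sqrt pi + 3, w <= n%:R & 0 <= w].
Proof.
have sp1 := @sqrt_pi_ge1 R; have sp0 : 0 < Num.sqrt pi :> R := lt_le_trans ltr01 sp1.
have n1 : 1 <= n%:R :> R by rewrite ler1n.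
have nub := n_ub; have nlb := n_lb; have p2 := pi_ge2 R.
set a := Num.sqrt (m%:R : R); have a0 : 0 <= a by exact: sqrtr_ge0.
have a2 : a ^+ 2 = m%:R by rewrite sqr_sqrtr.
have w0 : 0 <= w by exact: sqrtr_ge0.
have w2 : (w * Num.sqrt pi) ^+ 2 = 2 * n%:R.
  have pi0 := @pi_gt0 R; rewrite exprMn /w !sqr_sqrtr ?(ltW pi0) //.
    by rewrite divfK // gt_eqF.
  by rewrite divr_ge0 ?(ltW pi0).
split=> //.
- rewrite ler_pdivrMr //; apply: le_of_le_sqr; first by rewrite mulr_ge0 // ltW.
  by rewrite w2 exprMn a2; lra.
- rewrite (_ : _ + 3 = (2 * a + 3 * Num.sqrt pi) / Num.sqrt pi); last first.
    by field; rewrite gt_eqF.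
  rewrite ler_pdivlMr //.
  have wp : w * Num.sqrt pi <= 2 * a + 3.
    apply: le_of_le_sqr; first by lra.
    by rewrite w2; lra.
  by lra.
- apply: le_trans (_ : Num.sqrt (n%:R) <= _); last exact: le_sqrtr_self.
  by rewrite ler_sqrt // ler_pdivrMr ?pi_gt0 //; have := ler_wpM2l (ler0n R n) p2; lra.
Qed.

Let c_bounds : 2 * Num.sqrt m%:R / Num.sqrt pi <= c <= 2 * Num.sqrt m%:R / Num.sqrt pi + 3.
Proof.
have sp1 := @sqrt_pi_ge1 R; have sp0 : 0 < Num.sqrt pi :> R := lt_le_trans ltr01 sp1.
apply/andP; split.
  have [->|m0] := posnP m; last exact: sign_slope_lb.
  by rewrite sqrtr0 mulr0 mul0r sign_slope_ge0.
apply: le_trans (sign_slope_ub m) _.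
rewrite (_ : _ + 3 = (2 * Num.sqrt m%:R + 3 * Num.sqrt pi) / Num.sqrt pi); last first.
  by field; rewrite gt_eqF.
rewrite ler_pM2r ?invr_gt0 //.
have : Num.sqrt (m%:R + 3 / 2) <= Num.sqrt m%:R + 3 / 2 :> R.
  apply: le_of_le_sqr; first by rewrite addr_ge0 // sqrtr_ge0.
  by rewrite sqrrD !sqr_sqrtr ?addr_ge0 //; have := sqrtr_ge0 (m%:R : R); lra.
by lra.
Qed.

(** From k <= exp(-eps^2) and n <= 2m + 2, k^(m+1) <= exp(-q/2). For eps > 1/2 this is already
    O(1/n). Otherwise, replacing exp(-q/2) by sqrt k exp(-q/(2k)) costs at most eps^2 (1 + q)
    exp(-q/2), and n times this is (q + q^2) exp(-q/2) <= 2 + 16. *)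
Lemma central_term_ub : k ^+ m.+1 <= Num.sqrt k * expR (- (q / (2 * k))) + 18 / n%:R.
Proof.
have q0 : 0 <= q by rewrite mulr_ge0 ?sqr_ge0.
have nlb := n_lb; have nub := n_ub.
have kexp : k <= expR (- eps ^+ 2) by have := expR_ge1Dx (- eps ^+ 2); rewrite /k /kappa; lra.
have kq : k ^+ m.+1 <= expR (- (q / 2)).
  apply: le_trans (lerXn2r m.+1 _ _ kexp) _; rewrite ?nnegrE ?expR_ge0 ?(ltW k0) //.
  rewrite -expRM_natl ler_expR mulrN lerN2 /q -[m.+1%:R]natr1.
  by have := ler_wpM2r (sqr_ge0 eps) nub; lra.
have sk : k <= Num.sqrt k.
  by apply: le_of_le_sqr; rewrite ?sqrtr_ge0 // sqr_sqrtr ?(ltW k0) //; have := k0; have := k1; nra.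
have [eh|eh] := leP eps 2^-1; last first.
  have X : expR (- (q / 2)) <= 18 / n%:R.
    rewrite ler_pdivlMr //; have := expRN_mul_le1 (divr_ge0 q0 (ler0n R 2)).
    have e4 : 1 <= 4 * eps ^+ 2 by nra.
    have q4 : n%:R <= 4 * q by have := ler_wpM2l (ler0n R n) e4; rewrite /q; lra.
    by have := ler_wpM2l (expR_ge0 (- (q / 2))) q4; lra.
  by apply: le_trans kq (le_trans X _); rewrite lerDr mulr_ge0 ?sqrtr_ge0 ?expR_ge0.
apply: le_trans (kq) _; rewrite -lerBlDl.
have ek : expR (- (q / (2 * k))) = expR (- (q / 2)) * expR (- (q * eps ^+ 2 / (2 * k))).
  by rewrite -expRD; congr expR; rewrite /k /kappa; field; rewrite gt_eqF // k0.
set E := expR (- (q / 2)) in kq ek *; set f := expR (- (q * eps ^+ 2 / (2 * k))) in ek *.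
have E0 : 0 < E := expR_gt0 _; have f0 : 0 < f := expR_gt0 _.
have f1 : f <= 1.
  rewrite -[leRHS]expR0 ler_expR oppr_le0.
  by apply: divr_ge0; apply: mulr_ge0; rewrite ?sqr_ge0 ?(ltW k0).
have kh : 1 <= 2 * k by have := e0; rewrite /k /kappa; nra.
have flb : 1 - q * eps ^+ 2 <= f.
  have := expR_ge1Dx (- (q * eps ^+ 2 / (2 * k))); rewrite -/f.
  have : q * eps ^+ 2 / (2 * k) <= q * eps ^+ 2.
    by rewrite ler_pdivrMr ?mulr_gt0 // ler_peMr // mulr_ge0 ?sqr_ge0.
  by lra.
have skf : 1 - Num.sqrt k * f <= eps ^+ 2 * (1 + q).
  have := ler_wpM2r (ltW f0) sk; have := ler_wpM2l (sqr_ge0 eps) f1.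
  by rewrite [in X in _ -> X -> _]/k /kappa; lra.
have Eq : E * q <= 2.
  by have := expRN_mul_le1 (divr_ge0 q0 (ler0n R 2)); rewrite -/E; lra.
have Eq2 : E * q ^+ 2 <= 16.
  have h := expRN_mul_le1 (divr_ge0 q0 (ler0n R 4)).
  have h0 : 0 <= q / 4 * expR (- (q / 4)) by rewrite mulr_ge0 ?divr_ge0 ?expR_ge0.
  have EE : E = expR (- (q / 4)) ^+ 2 by rewrite -expRM_natl; congr expR; lra.
  have := ler_pM h0 h0 h h; rewrite EE; lra.
rewrite ek ler_pdivlMr //.
have := ler_wpM2l (ltW E0) skf.
have := ler_wpM2r (ler0n R n); move/(_ _ _ (ler_wpM2l (ltW E0) skf)).
have -> : E * (eps ^+ 2 * (1 + q)) * n%:R = E * q + E * q ^+ 2 by rewrite /q; ring.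
by lra.
Qed.

(** With r = eps^2 / k, 1/k = 1 + r gives k >= exp(-r). Since 2m + 1 <= n, k^(m+1) >= B exp(-r/2) >=
    B (1 - r/2) with B = exp(-n r/2), and B n r/2 <= 1. *)
Lemma central_term_lb : Num.sqrt k * expR (- (q / (2 * k))) <= k ^+ m.+1 + 1 / n%:R.
Proof.
have q0 : 0 <= q by rewrite mulr_ge0 ?sqr_ge0.
have nlb := n_lb; set r := eps ^+ 2 / k; have r0 : 0 <= r by rewrite divr_ge0 ?sqr_ge0 ?(ltW k0).
have qr : q / (2 * k) = n%:R * (r / 2) by rewrite /q /r; field; rewrite gt_eqF.
have kexp : expR (- r) <= k.
  have kV : k^-1 = 1 + r by rewrite /r /k /kappa; field; rewrite gt_eqF.
  by rewrite expRN -[leRHS]invrK lef_pV2 ?posrE ?expR_gt0 ?invr_gt0 // kV expR_ge1Dx.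
set B := expR (- (q / (2 * k))); have B0 : 0 < B := expR_gt0 _.
have lb : B * (1 - r / 2) <= k ^+ m.+1.
  apply: le_trans (lerXn2r m.+1 _ _ kexp); rewrite ?nnegrE ?expR_ge0 ?(ltW k0) //.
  apply: le_trans (_ : B * expR (- (r / 2)) <= _).
    by rewrite ler_wpM2l ?(ltW B0) //; exact: expR_ge1Dx.
  rewrite -expRM_natl -expRD ler_expR qr -[m.+1%:R]natr1.
  by have := ler_wpM2r r0 nlb; lra.
have Br : B * (r / 2) <= 1 / n%:R.
  rewrite ler_pdivlMr //; have := expRN_mul_le1 (divr_ge0 q0 (ltW (mulr_gt0 (ltr0Sn R 1) k0))).
  by rewrite -/B qr; lra.
have s1 : Num.sqrt k <= 1 by rewrite -[leRHS]sqrtr1 ler_sqrt ?(ltW k1).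
have := ler_wpM2r (ltW B0) s1; lra.
Qed.

Lemma walk_norm_gauss_mean : `|walk_mean eps n Num.norm 0 - gauss_abs_mean eps n| <= 27.
Proof.
rewrite walk_mean_norm // -/m -/P -/c /gauss_abs_mean -/k -/z -/q.
have -> : 1 - eps ^+ 2 = k by [].
have -> : Num.sqrt (2 * k * n%:R / pi) = Num.sqrt k * w.
  by rewrite /w -(sqrtrM _ (ltW k0)); congr Num.sqrt; ring.
have [w1 w2 w3 w4] := w_bounds; have /andP[c1 c2] := c_bounds.
have ub := central_term_ub; have lb := central_term_lb.
have h1 : `|n%:R * eps * P - n%:R * eps * erf z| <= 6.
  by rewrite -mulrBr normrM (ger0_norm (mulr_ge0 (ltW nR0) (ltW e0))) sign_poly_erf_scaled.
set K := k ^+ m.+1 in ub lb; set B := Num.sqrt k * expR (- (q / (2 * k))) in ub lb.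
have -> : k * c * k ^+ m = c * K by rewrite /K exprS; ring.
have -> : Num.sqrt k * w * expR (- (q / (2 * k))) = w * B by rewrite /B; ring.
have K0 : 0 <= K by rewrite exprn_ge0 ?(ltW k0).
have K1 : K <= 1 by rewrite exprn_ile1 ?(ltW k0) ?(ltW k1).
have wn (x : R) : 0 <= x -> w * (x / n%:R) <= x.
  move=> x0; rewrite mulrA ler_pdivrMr // mulrC ler_wpM2l //.
have n18 := wn 18 (ler0n R 18); have n1 := wn 1 ler01.
(* 21 = 3 + 18: the gap between [c] and [w], with K <= 1, and then w times 18/n; adding 6 from the
   sign term gives 27. *)
have h2 : `|c * K - w * B| <= 21.
  have := ler_wpM2l w4 ub; have := ler_wpM2l w4 lb; rewrite !mulrDr.
  have cw : c <= w + 3 by lra.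
  have wc : w <= c + 3 by lra.
  have := ler_wpM2r K0 cw; have := ler_wpM2r K0 wc; rewrite ler_norml; lra.
move: h1 h2; rewrite !ler_norml => /andP[? ?] /andP[? ?]; apply/andP; split; lra.
Qed.

End fixed_horizon.
End numerical_comparison.

(** * The regret gap *)

(** In E|S_n| - E sgn(S_n) / eps the visits to 0 cancel, and each step adds eps E sgn(S_n); the sum
    telescopes. *)
Lemma sum_walk_mean_sg (R : realType) (eps : R) (n : nat) : eps != 0 ->
  eps * \sum_(k < n) walk_mean eps k Num.sg 0 =
  walk_mean eps n Num.norm 0 - eps^-1 * walk_mean eps n Num.sg 0.
Proof.
move=> e0; elim: n => [|n IHn].
  by rewrite big_ord0 !walk_mean0 normr0 sgr0 !mulr0 subrr.
by rewrite big_ord_recr /= mulrDr IHn walk_mean_normS walk_mean_sgS; field.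
Qed.

Lemma regret_gap_bound (R : realType) (eps : R) (T : nat) : 0 < eps -> eps < 1 -> (1 <= T)%N ->
  `| u eps (sigma0 eps) (b0 eps) 0 (eps * T%:R, eps * T%:R) (- T%:R)
     - v eps 0 (eps * T%:R, eps * T%:R) (- T%:Z) | <= 60.
Proof.
move=> e0 e1 T0; have e01 : 0 < eps < 1 by rewrite e0.
have T20 : (0 < T.*2)%N by rewrite double_gt0.
have natT2 : T.*2%:R = 2 * T%:R :> R by rewrite -mul2n natrM.
rewrite /u /u_n /u_h /v abszN absz_nat value_walk_mean /=.
(* At this initial state both shifted coordinates are 0, so the walks start at 0, and [u_h] becomes
   half of E|N| for horizon 2T. *)
have -> : eps * T%:R + eps * T%:R = T.*2%:R * eps by rewrite natT2; ring.
have -> : 2 * - T%:R = - T.*2%:R :> R by rewrite natT2; ring.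
have -> : T.*2%:R * eps - eps * T%:R *+ 2 = 0 by rewrite natT2; ring.
rewrite mulrN subrr sum_walk_mean_sg ?gt_eqF // Rintegral_Phi_norm //.
have -> : varphi eps (sigma0 eps) (b0 eps) 0 = 0 by rewrite /varphi lexx oppr0.
rewrite [eps * T%:R]mulrC.
have := varphi_hat_bound e01 T0; have := sign_poly_erf_div e01 T0.
have := walk_norm_gauss_mean e01 T0; have := walk_norm_gauss_mean e01 T20.
rewrite -walk_mean_sg //.
set A2 := walk_mean _ T.*2 _ _; set A := walk_mean _ T Num.norm _.
set P := walk_mean _ T Num.sg _; set E := erf _; set H := varphi_hat _ _ _ _ _.
move: (gauss_abs_mean _ _) (gauss_abs_mean _ _) => B2 B h1 h2.
have epsV (x : R) : eps^-1 * `|x| = `|eps^-1 * x| by rewrite normrM gtr0_norm ?invr_gt0.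
rewrite epsV mulrBr.
move: (eps^-1 * P) (eps^-1 * E) => P' E'.
move: h1 h2; rewrite !ler_norml => /andP[? ?] /andP[? ?] /andP[? ?] /andP[? ?].
(* The errors add up to 27/2 + 27 + 4 + 8, below 60. *)
by apply/andP; split; lra.
Qed.

Lemma sigma0_gt0 (R : realType) (eps : R) : 0 < eps < 1 -> 0 < sigma0 eps.
Proof.
move=> e01; have l0 := log_odds_gt0 e01; case/andP: e01 => e0 _.
by rewrite /sigma0 -/(log_odds eps) divr_gt0 // mulr_gt0.
Qed.

(* E0 eps (- T) is the error term; its constants depend on neither eps nor T. *)
Theorem mainTheorem3 (R : realType) :
  exists E0 : R -> int -> R,
    [/\ forall (eps : R) (T : nat), 0 < eps -> eps < 1 -> (1 <= T)%N ->
          `| u eps (sigma0 eps) (b0 eps) 0 (eps * T%:R, eps * T%:R) (- T%:R)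
             - v eps 0 (eps * T%:R, eps * T%:R) (- T%:Z) |
          <= E0 eps (- T%:Z),
        exists C : R,
          forall (eps : R) (T : nat), 0 < eps -> eps < 1 -> (1 <= T)%N ->
            `| E0 eps (- T%:Z) |
            <= C * (1 + (1 + 1 / sigma0 eps) * Num.sqrt (kappa eps))
      & exists C eps0 : R, 0 < eps0 /\
          forall (eps : R) (T : nat), 0 < eps -> eps < 1 -> eps < eps0 ->
            (1 <= T)%N -> `| E0 eps (- T%:Z) | <= C].
Proof.
(* A constant error term suffices: the factor 1 + (1 + 1/sigma) sqrt kappa is at least 1. *)
exists (fun _ _ => 60); split.
- exact: regret_gap_bound.
- exists 60 => eps T e0 e1 _; have s0 : 0 < sigma0 eps by rewrite sigma0_gt0 // e0.
  rewrite ger0_norm // -[leLHS]mulr1 ler_wpM2l // lerDl mulr_ge0 ?sqrtr_ge0 // addr_ge0 //.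
  by rewrite divr_ge0 // ltW.
- by exists 60, 1; split=> // *; rewrite ger0_norm.
Qed.
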